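(* Let $N\in\{4,5,6,7,9,10,12\}$, let $\alpha\in\mathbb{Z}$ be an admissible parameter, and let $E_N$ be the (integral) Tate normal form with parameter $\alpha$, on which $P=(0,0)$ is a torsion point of order $N$ (see context). Let $H_n=\omega_n(P)$, $n\ge0$, be the sequence of numerators of the $y$-coordinates of the multiples of $P$, and let $n\ge0$ be such that $H_n\neq0$. (''For all $\alpha$'' means for all admissible $\alpha$.) 1. $N=4$. (i) If $n\equiv0,3,4\ (8)$, then $H_n=\square$ for all $\alpha$; otherwise $H_n=\square$ iff $\alpha=\square$. (ii) If $n\equiv0\ (4)$, then $H_n=C$ for all $\alpha$; otherwise $H_n=C$ iff $\alpha=C$. 2. $N=5$. (i) If $n\equiv0\ (5)$, then $H_n=\square$ for all $\alpha$; otherwise $H_n=\square$ iff $\alpha=\square$. (ii) If $n\equiv0\ (5)$, then $H_n=C$ for all $\alpha$; otherwise $H_n=C$ iff $\alpha=C$. 3. $N=6$. (i) If $n\equiv0,8\ (12)$, then $H_n=\square$ for all $\alpha$; if $n\equiv2,6\ (12)$, then $H_n=\square$ iff $\alpha=\square$; otherwise $H_n\ne\square$ for all $\alpha$. (ii) If $n\equiv0\ (6)$, then $H_n=C$ for all $\alpha$; if $n\equiv3\ (6)$, then $H_n=C$ iff $\alpha=C$; otherwise $H_n\neq C$ for all $\alpha$. 4. $N=7$. (i) If $n\equiv0,9,10\ (14)$, then $H_n=\square$ for all $\alpha$; if $n\equiv4,6\ (14)$, then $H_n=\square$ iff $\alpha=\square$; if $n\equiv11,13\ (14)$, then $H_n=\square$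 iff $\alpha-1=\square$; otherwise $H_n\ne\square$ for all $\alpha$. (ii) If $n\equiv0\ (7)$, then $H_n=C$ for all $\alpha$; if $n\equiv2\ (7)$, then $H_n=C$ iff $\alpha-1=C$; otherwise $H_n\ne C$ for all $\alpha$. 5. $N=9$. (i) If $n\equiv0,13,14\ (18)$, then $H_n=\square$ for all $\alpha$; if $n\equiv2,12\ (18)$, then $H_n=\square$ iff $\alpha-1=\square$; otherwise $H_n\ne\square$ for all $\alpha$. (ii) If $n\equiv0\ (9)$, then $H_n=C$ for all $\alpha$; if $n\equiv3\ (9)$, then $H_n=C$ iff $\alpha-1=C$; otherwise $H_n\ne C$ for all $\alpha$. 6. $N=10$. (i) If $n\equiv0,5,15,16\ (20)$, then $H_n=\square$ for all $\alpha$; if $n\equiv4,12\ (20)$, then $H_n=\square$ iff $2\alpha-1=\square$; if $n\equiv3,13\ (20)$, then $H_n=\square$ iff $(\alpha-1)(2\alpha-1)=\square$; otherwise $H_n\ne\square$ for all $\alpha$. (ii) If $n\equiv0\ (10)$, then $H_n=C$ for all $\alpha$; otherwise $H_n\ne C$ for all $\alpha$. 7. $N=12$. (i) If $n\equiv0,8,12,19,20\ (24)$, then $H_n=\square$ for all $\alpha$; if $n\equiv4,16\ (24)$, then $H_n=\square$ iff $2\alpha-2\alpha^2-1=\square$; otherwise $H_n\ne\square$ for all $\alpha$. (ii) If $n\equiv0\ (12)$, then $H_n=C$ for all $\alpha$; otherwise $H_n\neq C$ for all $\alpha$.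
   Context: Notation: ''$m=\square$'' means $m=\pm k^2$ for some non-zero integer $k$ (note the sign $\pm$); ''$m=C$'' means $m=k^3$ for some non-zero integer $k$; $n\equiv r\ (N)$ means congruence modulo $N$. The curves $E_N$. For $N=4,5,6,7,9$, $E_N:\ y^2+(1-c)xy-by=x^3-bx^2$ with: $N=4$: $b=\alpha$, $c=0$; $N=5$: $b=c=\alpha$; $N=6$: $b=\alpha+\alpha^2$, $c=\alpha$; $N=7$: $b=\alpha^3-\alpha^2$, $c=\alpha^2-\alpha$; $N=9$: $c=\alpha^2(\alpha-1)$, $b=c(\alpha(\alpha-1)+1)$. For $N=10,12$ an integral model is used: with $\beta=(2\alpha-1)(\alpha-1)$, $\zeta=-\alpha^2+3\alpha-1$, $\lambda=(3\alpha^2-3\alpha+1)(\alpha-2\alpha^2)$, $\theta=2\alpha-2\alpha^2-1$, $E_{10}:\ y^2+(\zeta^2-\alpha\beta\zeta)xy-\alpha^3\beta\zeta^4y=x^3-\alpha^3\beta\zeta^2x^2$, $E_{12}:\ y^2+(\alpha-1)((\alpha-1)^3-\lambda)xy-(\alpha-1)^8\lambda\theta y=x^3-(\alpha-1)^4\lambda\theta x^2$. Admissible integers $\alpha$: $\alpha\ne0$ for $N=4,5$; $\alpha\neq-1,0$ for $N=6$; $\alpha\ne0,1$ for $N=7,9,10,12$. Division polynomials. For an elliptic curve $y^{2}+a_{1}xy+a_{3}y=x^{3}+a_{2}x^{2}+a_{4}x+a_{6}$ put $b_2=a_1^2+4a_2$, $b_4=2a_4+a_1a_3$, $b_6=a_3^2+4a_6$,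 $b_8=a_1^2a_6+4a_2a_6-a_1a_3a_4+a_2a_3^2-a_4^2$. Define $\psi_0=0$, $\psi_1=1$, $\psi_2=2y+a_1x+a_3$, $\psi_3=3x^4+b_2x^3+3b_4x^2+3b_6x+b_8$, $\psi_4=\psi_2\,(2x^6+b_2x^5+5b_4x^4+10b_6x^3+10b_8x^2+(b_2b_8-b_4b_6)x+(b_4b_8-b_6^2))$, and $\psi_{2n+1}=\psi_{n+2}\psi_n^3-\psi_{n-1}\psi_{n+1}^3$ $(n\ge2)$, $\psi_{2n}\psi_2=\psi_{n-1}^2\psi_n\psi_{n+2}-\psi_{n-2}\psi_n\psi_{n+1}^2$ $(n\ge3)$. Further $\phi_0=1$, $\phi_1=x$, $\omega_0=1$, $\omega_1=y$, and for $n\ge2$: $\phi_n=x\psi_n^2-\psi_{n+1}\psi_{n-1}$, $\omega_n=\bigl(\psi_{n-1}^2\psi_{n+2}-\psi_{n-2}\psi_{n+1}^2-\psi_2\psi_n(a_1\phi_n+a_3\psi_n^2)\bigr)/(2\psi_2)$. If $\psi_n(P)\ne0$ then $[n]P=(\phi_n(P)/\psi_n(P)^2,\ \omega_n(P)/\psi_n(P)^3)$. *)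

(* Defs.v *)
From mathcomp Require Import all_boot all_order all_algebra.
From mathcomp Require Import ring zify.

Set Implicit Arguments.
Unset Strict Implicit.
Unset Printing Implicit Defensive.

Import GRing.Theory.
Local Open Scope ring_scope.

(* Coefficients of y^2 + a1 xy + a3 y = x^3 + a2 x^2 + a4 x + a6. *)
Record weierstrass := Weierstrass {
  wa1 : int; wa2 : int; wa3 : int; wa4 : int; wa6 : int }.

(* Polynomials in x and y over the rationals: the outer variable is y and the
   inner one is x.  The division polynomials are taken before reduction modulo
   the equation of the curve, which does not affect their values at points of
   the curve.  Both psi_2 = 2 y + ... and 2 psi_2 have a unit of {poly rat} as
   leading coefficient in y, so that %/ below is the Euclidean quotient by
   them; the divisions are exact (psi_even, omega_ge2). *)
Notation polyxy := {poly {poly rat}}.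

Definition vx : polyxy := ('X)%:P.
Definition vy : polyxy := 'X.

Definition evalxy (p : polyxy) (x y : rat) : rat := p.[y%:P].[x].

Section DivisionPolynomials.

Variable E : weierstrass.

Let a1 : polyxy := (wa1 E)%:~R.
Let a2 : polyxy := (wa2 E)%:~R.
Let a3 : polyxy := (wa3 E)%:~R.
Let a4 : polyxy := (wa4 E)%:~R.
Let a6 : polyxy := (wa6 E)%:~R.

Let b2 := a1 ^+ 2 + 4 * a2.
Let b4 := 2 * a4 + a1 * a3.
Let b6 := a3 ^+ 2 + 4 * a6.
Let b8 := a1 ^+ 2 * a6 + 4 * a2 * a6 - a1 * a3 * a4 + a2 * a3 ^+ 2 - a4 ^+ 2.

Definition psi2 : polyxy := 2 * vy + a1 * vx + a3.

Definition psi3 : polyxy :=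
  3 * vx ^+ 4 + b2 * vx ^+ 3 + 3 * b4 * vx ^+ 2 + 3 * b6 * vx + b8.

Definition psi4 : polyxy :=
  psi2 * (2 * vx ^+ 6 + b2 * vx ^+ 5 + 5 * b4 * vx ^+ 4 + 10 * b6 * vx ^+ 3
          + 10 * b8 * vx ^+ 2 + (b2 * b8 - b4 * b6) * vx + (b4 * b8 - b6 ^+ 2)).

(* psi_fuel k n is psi_n as soon as n <= k (psi_fuelE). *)
Fixpoint psi_fuel (k n : nat) : polyxy :=
  if k is k'.+1 then
    let psi := psi_fuel k' in
    match n with
    | 0 => 0
    | 1 => 1
    | 2 => psi2
    | 3 => psi3
    | 4 => psi4
    | _ => let m := n./2 in
      if odd n then psi m.+2 * psi m ^+ 3 - psi m.-1 * psi m.+1 ^+ 3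
      else (psi m.-1 ^+ 2 * psi m * psi m.+2
            - psi m.-2 * psi m * psi m.+1 ^+ 2) %/ psi2
    end
  else 0.

Definition psi (n : nat) : polyxy := psi_fuel n n.

Definition phi (n : nat) : polyxy :=
  match n with
  | 0 => 1
  | 1 => vx
  | _ => vx * psi n ^+ 2 - psi n.+1 * psi n.-1
  end.

Definition omega (n : nat) : polyxy :=
  match n with
  | 0 => 1
  | 1 => vy
  | _ => (psi n.-1 ^+ 2 * psi n.+2 - psi n.-2 * psi n.+1 ^+ 2
          - psi2 * psi n * (a1 * phi n + a3 * psi n ^+ 2)) %/ (2 * psi2)
  end.

Lemma psi_fuelE k n : (n <= k)%N -> psi_fuel k n = psi n.
Proof.
rewrite /psi; elim/ltn_ind: k n => -[|k] IH n lenk.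
  by case: n lenk.
case: n lenk => [|n] // lenk /=.
case: n lenk => [|[|[|[|n]]]] // lenk.
set m := n.+4.+1./2.
have E1 j : (j < n.+4.+1)%N -> psi_fuel k j = psi_fuel n.+4 j.
  by move=> ltj; rewrite (IH k) ?(IH n.+4) //; lia.
case: ifP => odn; rewrite !E1 // /m; lia.
Qed.

Lemma psi_rec n (m := n./2) : (5 <= n)%N ->
  psi n = if odd n then psi m.+2 * psi m ^+ 3 - psi m.-1 * psi m.+1 ^+ 3
          else (psi m.-1 ^+ 2 * psi m * psi m.+2
                - psi m.-2 * psi m * psi m.+1 ^+ 2) %/ psi2.
Proof.
rewrite {}/m; case: n => [|[|[|[|[|n]]]]] // _.
set m := n.+4.+1./2.
transitivity (if odd n.+4.+1
  then psi_fuel n.+4 m.+2 * psi_fuel n.+4 m ^+ 3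
       - psi_fuel n.+4 m.-1 * psi_fuel n.+4 m.+1 ^+ 3
  else (psi_fuel n.+4 m.-1 ^+ 2 * psi_fuel n.+4 m * psi_fuel n.+4 m.+2
        - psi_fuel n.+4 m.-2 * psi_fuel n.+4 m * psi_fuel n.+4 m.+1 ^+ 2)
         %/ psi2); first by [].
case: ifP => odn; rewrite !psi_fuelE // /m; lia.
Qed.

Lemma psi_odd n : (2 <= n)%N ->
  psi n.*2.+1 = psi n.+2 * psi n ^+ 3 - psi n.-1 * psi n.+1 ^+ 3.
Proof.
move=> n2; rewrite psi_rec; last by lia.
by rewrite [odd _]/= odd_double [_./2]uphalf_double.
Qed.

Lemma psi_even_div n : (3 <= n)%N ->
  psi n.*2 = (psi n.-1 ^+ 2 * psi n * psi n.+2
              - psi n.-2 * psi n * psi n.+1 ^+ 2) %/ psi2.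
Proof.
move=> n3; rewrite psi_rec; last by lia.
by rewrite odd_double doubleK.
Qed.

Lemma psi2E : psi2 = (2%:P : polyxy) * 'X
  + ((wa1 E)%:~R * 'X + (wa3 E)%:~R : {poly rat})%:P.
Proof.
rewrite /psi2 /a1 /a3 /vx /vy [X in _ = _ + X]polyCD polyCM !rmorph_int.
by rewrite -[2 in RHS]/(2%:R) rmorph_nat addrA.
Qed.

Lemma lead_coef_psi2 : lead_coef psi2 = 2.
Proof.
rewrite psi2E mul_polyC lead_coefDl.
  by rewrite lead_coefZ lead_coefX mulr1.
rewrite size_scale ?size_polyX ?ltnS ?size_polyC_leq1 //.
by rewrite -[2]/(2%:R) -polyC_natr polyC_eq0.
Qed.

Lemma two_unit : (2 : {poly rat}) \is a GRing.unit.
Proof. by rewrite -[2]/(2%:R) -polyC_natr poly_unitE size_polyC coefC. Qed.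

Lemma lead_psi2_unit : lead_coef psi2 \is a GRing.unit.
Proof. by rewrite lead_coef_psi2 two_unit. Qed.

Lemma two_psi2_unit : lead_coef (2 * psi2) \is a GRing.unit.
Proof.
have -> : 2 * psi2 = (2 : {poly rat}) *: psi2.
  by rewrite -mul_polyC -[2 in RHS]/(2%:R) rmorph_nat.
by rewrite lead_coefZ lead_coef_psi2 unitrM two_unit.
Qed.

Lemma psi2_dvd_even_psi n : ~~ odd n -> psi2 %| psi n.
Proof.
have U := lead_psi2_unit.
have dvdP q : reflect (exists r, q = r * psi2) (psi2 %| q).
  exact: Pdiv.IdomainUnit.dvdpP.
elim/ltn_ind: n => n IH evn.
have [n0|n0] := leqP n 4.
  case: n n0 evn {IH} => [|[|[|[|[|n]]]]] // _ _.
  by rewrite /psi /= /psi4; apply/dvdP; rewrite mulrC; eexists.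
have [m en] : exists m, n = m.*2.
  by exists n./2; rewrite -[LHS]odd_double_half (negPf evn).
subst n; have m3 : (3 <= m)%N by lia.
rewrite psi_even_div //; case: (boolP (odd m)) => om.
  have /dvdP[r Er] : psi2 %| psi m.-1 by apply: IH; lia.
  have /dvdP[s Es] : psi2 %| psi m.+1 by apply: IH; lia.
  have -> : psi m.-1 ^+ 2 * psi m * psi m.+2 - psi m.-2 * psi m * psi m.+1 ^+ 2
     = psi2 * (psi2 * (r ^+ 2 * psi m * psi m.+2
                        - psi m.-2 * psi m * s ^+ 2)).
    by rewrite Er Es; ring.
  rewrite Pdiv.IdomainUnit.mulKp //.
  by apply/dvdP; rewrite mulrC; eexists.
have /dvdP[r Er] : psi2 %| psi m by apply: IH; lia.
have /dvdP[s Es] : psi2 %| psi m.+2 by apply: IH; lia.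
have /dvdP[t Et] : psi2 %| psi m.-2 by apply: IH; lia.
have -> : psi m.-1 ^+ 2 * psi m * psi m.+2 - psi m.-2 * psi m * psi m.+1 ^+ 2
   = psi2 * (psi2 * (psi m.-1 ^+ 2 * r * s - t * r * psi m.+1 ^+ 2)).
  by rewrite Er Es Et; ring.
rewrite Pdiv.IdomainUnit.mulKp //.
by apply/dvdP; rewrite mulrC; eexists.
Qed.

Lemma psi_even n : (3 <= n)%N ->
  psi n.*2 * psi2 = psi n.-1 ^+ 2 * psi n * psi n.+2
                    - psi n.-2 * psi n * psi n.+1 ^+ 2.
Proof.
move=> n3; rewrite psi_even_div // Pdiv.IdomainUnit.divpK ?lead_psi2_unit //.
case: (boolP (odd n)) => on; apply: dvdp_sub.
- do 3 apply: dvdp_mulr.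
  by apply: psi2_dvd_even_psi; lia.
- apply: dvdp_mull; apply: dvdp_mulr.
  by apply: psi2_dvd_even_psi; lia.
- by apply: dvdp_mull; apply: psi2_dvd_even_psi; lia.
- apply: dvdp_mulr; apply: dvdp_mull.
  by apply: psi2_dvd_even_psi; lia.
Qed.

Lemma omega_ge2 n : (2 <= n)%N ->
  omega n * (2 * psi2) =
    psi n.-1 ^+ 2 * psi n.+2 - psi n.-2 * psi n.+1 ^+ 2
    - psi2 * psi n * (a1 * phi n + a3 * psi n ^+ 2).
Proof.
case: n => [|[|n]] // _; rewrite /omega.
rewrite Pdiv.IdomainUnit.divpK ?two_psi2_unit //.
have dvd2 p : psi2 %| p -> 2 * psi2 %| p.
  have -> : 2 * psi2 = (2 : {poly rat}) *: psi2.
    by rewrite -mul_polyC -[2 in RHS]/(2%:R) rmorph_nat.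
  by rewrite dvdpZl //; apply: contraTneq two_unit => ->; rewrite unitr0.
apply: dvd2; apply: dvdp_sub; last by rewrite -mulrA dvdp_mulr.
case: (boolP (odd n)) => on; apply: dvdp_sub.
- by apply: dvdp_mulr; apply: dvdp_mulr; apply: psi2_dvd_even_psi; rewrite /= on.
- by apply: dvdp_mull; apply: dvdp_mulr; apply: psi2_dvd_even_psi; rewrite /= on.
- by apply: dvdp_mull; apply: psi2_dvd_even_psi; rewrite /= !negbK.
- by apply: dvdp_mulr; apply: psi2_dvd_even_psi; rewrite /= on.
Qed.

End DivisionPolynomials.

(* omega_n(P) for P = (0, 0). *)
Definition Hnum (E : weierstrass) (n : nat) : rat := evalxy (omega E n) 0 0.

(* y^2 + (1 - c) xy - b y = x^3 - b x^2 *)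
Definition tate (b c : int) : weierstrass :=
  Weierstrass (1 - c) (- b) (- b) 0 0.

Definition E4 (alpha : int) := tate alpha 0.
Definition E5 (alpha : int) := tate alpha alpha.
Definition E6 (alpha : int) := tate (alpha + alpha ^+ 2) alpha.
Definition E7 (alpha : int) :=
  tate (alpha ^+ 3 - alpha ^+ 2) (alpha ^+ 2 - alpha).
Definition E9 (alpha : int) :=
  let c := alpha ^+ 2 * (alpha - 1) in
  tate (c * (alpha * (alpha - 1) + 1)) c.
Definition E10 (alpha : int) :=
  let beta := (2 * alpha - 1) * (alpha - 1) in
  let zeta := - alpha ^+ 2 + 3 * alpha - 1 in
  Weierstrass (zeta ^+ 2 - alpha * beta * zeta)
              (- (alpha ^+ 3 * beta * zeta ^+ 2))
              (- (alpha ^+ 3 * beta * zeta ^+ 4)) 0 0.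
Definition E12 (alpha : int) :=
  let lambda := (3 * alpha ^+ 2 - 3 * alpha + 1) * (alpha - 2 * alpha ^+ 2) in
  let theta := 2 * alpha - 2 * alpha ^+ 2 - 1 in
  Weierstrass ((alpha - 1) * ((alpha - 1) ^+ 3 - lambda))
              (- ((alpha - 1) ^+ 4 * lambda * theta))
              (- ((alpha - 1) ^+ 8 * lambda * theta)) 0 0.

(* Squares are meant up to sign, and zero is neither a square nor a cube. *)
Definition is_square (m : rat) : Prop :=
  exists2 k : int, k != 0 & m = (k ^+ 2)%:~R \/ m = - (k ^+ 2)%:~R.

Definition is_cube (m : rat) : Prop :=
  exists2 k : int, k != 0 & m = (k ^+ 3)%:~R.

(* Main.v *)
Require Import Defs.
From mathcomp Require Import all_boot all_order all_algebra.
From mathcomp Require Import ring zify.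

Set Implicit Arguments.
Unset Strict Implicit.
Unset Printing Implicit Defensive.

Import Order.TTheory GRing.Theory Num.Theory.
Local Open Scope ring_scope.

(** On each of the curves the values [W_n = psi_n(P)] and [H_n = omega_n(P)] at
    the torsion point [P] of order [N] are, up to sign, monomials in a few
    pairwise coprime polynomials in [alpha], such as [alpha], [alpha - 1] and
    [2 alpha - 1].  They are quasi-periodic: there are monomials [a], [b] with
    [a ^ 2 = b ^ N] such that [W_(n + N) = a b ^ n W_n], and therefore
    [H_(n + N) = a ^ 3 b ^ (3 n) H_n].  Conversely, a quasi-periodic sequence
    satisfies the recursions of the division polynomials as soon as it satisfies
    them over one period, and these determine it because [W_2] is not zero.  So
    the tables of the [W_r] and [H_r] with [r < N] are certified by finitely many
    polynomial identities in [alpha] ([Hnum_mono]); after division by the common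
    monomial factor these have small degree and are checked by computation
    ([vanishP]).

    Since the factors are pairwise coprime, [H_n] is a [p]-th power up to sign
    exactly when every factor whose exponent is not divisible by [p] is one
    ([Hnum_power]).  The set of these factors depends only on [n] modulo [p N],
    so that every assertion becomes a finite check on the tables ([class_checkP]).

    The classes in which [H_n] is never a square or a cube need Diophantine
    input.  Mostly, two consecutive integers would both be powers.  The other
    cases are the following: [alpha ^ 2 - alpha + 1] is not a square, being
    strictly between two; [2 alpha - 1] and [2 alpha - 2 alpha ^ 2 - 1] are not
    both squares up to sign, because this means [t ^ 4 + 1 = 2 u ^ 2], which
    leads to a Pythagorean triangle whose area is a square
    ([fourth_power_twice_square]); and three systems of cube conditions are
    excluded by comparing sizes ([no_cubes_zeta], [no_cubes_theta],
    [no_cubes_difference]). *)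

(** * Perfect powers *)

(** Zero is excluded, and the absolute value makes the sign irrelevant: for
    [p = 3] this is no restriction because [-1] is a cube, and for [p = 2] it is
    the convention of [is_square]. *)
Definition perfect_power (p : nat) (x : int) : Prop :=
  exists2 k : nat, (0 < k)%N & `|x|%N = (k ^ p)%N.

Lemma is_squareE (x : int) : is_square x%:~R <-> perfect_power 2 x.
Proof.
split=> [[k k0 eq_x]|[k k0 eq_x]].
  exists `|k|%N; first by rewrite absz_gt0.
  rewrite -abszX; case: eq_x => [/intr_inj ->//|].
  by rewrite -mulrNz => /intr_inj ->; rewrite abszN.
exists k%:Z; first by rewrite -lt0n.
rewrite -[k%:Z]natz -natrX natz -eq_x -mulrNz abszE.
by case: (ger0P x) => _; [left | right; rewrite opprK].
Qed.

Lemma is_cubeE (x : int) : is_cube x%:~R <-> perfect_power 3 x.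
Proof.
split=> [[k k0 /intr_inj ->]|[k k0 eq_x]].
  by exists `|k|%N; rewrite ?absz_gt0 // abszX.
have [x0|x0] := leP 0 x.
  exists k%:Z; first by rewrite -lt0n.
  by congr _%:~R; rewrite -[k%:Z]natz -natrX natz -eq_x; lia.
exists (- k%:Z); first by rewrite oppr_eq0 -lt0n.
by congr _%:~R; rewrite exprNn -[k%:Z]natz -natrX natz -eq_x; lia.
Qed.

Lemma perfect_power1 p : perfect_power p 1.
Proof. by exists 1%N => //; rewrite exp1n. Qed.

Lemma perfect_powerM p x y :
  perfect_power p x -> perfect_power p y -> perfect_power p (x * y).
Proof.
move=> [k k0 Ek] [l l0 El]; exists (k * l)%N; first by rewrite muln_gt0 k0.
by rewrite abszM Ek El expnMn.
Qed.

Lemma perfect_powerX p x n : perfect_power p x -> perfect_power p (x ^+ n).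
Proof.
move=> px; elim: n => [|n IHn]; first exact: perfect_power1.
by rewrite exprS; apply: perfect_powerM.
Qed.

Lemma perfect_power_exp p x : x != 0 -> perfect_power p (x ^+ p).
Proof. by move=> x0; exists `|x|%N; rewrite ?absz_gt0 // abszX. Qed.

Lemma perfect_power_neq0 p x : perfect_power p x -> x != 0.
Proof. by case=> k k0 Ek; rewrite -absz_eq0 Ek -lt0n expn_gt0 k0. Qed.

Lemma perfect_power_cancel p x y : (0 < p)%N -> y != 0 ->
  perfect_power p (y ^+ p * x) -> perfect_power p x.
Proof.
move=> p0 y0 [k k0]; rewrite abszM abszX => Ek.
have /dvdnP[m Em] : (`|y| %| k)%N by rewrite -(dvdn_pexp2r _ _ p0) -Ek dvdn_mulr.
have y_gt0 : (0 < `|y|)%N by rewrite absz_gt0.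
exists m; first by move: k0; rewrite Em muln_gt0 => /andP[].
apply/eqP; rewrite -(@eqn_pmul2l (`|y| ^ p)%N) ?expn_gt0 ?y_gt0 //.
by rewrite Ek Em expnMn mulnC.
Qed.

(** When [x] and [y] are coprime and [x * y] is the [p]-th power of [k], the
    [p]-th root of [x] is [gcd x k]. *)
Lemma coprime_power_nat p x y k : (0 < p)%N -> coprime x y ->
  (x * y = k ^ p)%N -> x = (gcdn x k ^ p)%N.
Proof.
move=> p0 cop Exy.
have [x0|x0] := posnP x.
  by move: Exy; rewrite x0 gcd0n mul0n.
have g0 : (0 < gcdn x k)%N by rewrite gcdn_gt0 x0.
have /dvdnP[u Eu] := dvdn_gcdl x k; have /dvdnP[v Ev] := dvdn_gcdr x k.
have copuv : coprime u v.
  by rewrite /coprime -(@eqn_pmul2r (gcdn x k)) // muln_gcdl -Eu -Ev mul1n.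
set g := gcdn x k in g0 Eu Ev *.
case: p p0 Exy => // p _.
move=> Exy; have {}Exy : (u * y = v ^ p.+1 * g ^ p)%N.
  apply/eqP; rewrite -(@eqn_pmul2r g) // -mulnA [(y * g)%N]mulnC mulnA -Eu.
  by rewrite Exy -mulnA -expnSr -expnMn -Ev.
have du : (u %| g ^ p)%N.
  by rewrite -(@Gauss_dvdr _ (v ^ p.+1)) ?coprimeXr // -Exy dvdn_mulr.
have dg : (g ^ p %| u)%N.
  rewrite -(@Gauss_dvdl _ _ y); first by rewrite Exy dvdn_mull.
  by apply: coprimeXl; apply: coprime_dvdl cop; rewrite dvdn_gcdl.
by rewrite {1}Eu expnSr; congr (_ * _)%N; apply/eqP; rewrite eqn_dvd du.
Qed.

Lemma coprime_perfect_power p x y : (0 < p)%N -> coprimez x y ->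
  perfect_power p (x * y) -> perfect_power p x.
Proof.
move=> p0 cop pxy; have xy0 := perfect_power_neq0 pxy; case: pxy => k k0.
rewrite abszM => /coprime_power_nat-/(_ p0 cop) Ex; exists (gcdn `|x| k) => //.
by rewrite gcdn_gt0 k0 orbT.
Qed.

(** With [e * u = 1 + p * v], the [p]-th power [x ^ (e * u)] is [x] times a
    [p]-th power. *)
Lemma perfect_power_root p e x : prime p -> ~~ (p %| e)%N ->
  perfect_power p (x ^+ e) -> perfect_power p x.
Proof.
move=> pp pe pxe; have p0 := prime_gt0 pp.
have e0 : (0 < e)%N by case: e pe {pxe}; rewrite ?dvdn0.
have x0 : x != 0 by move: (perfect_power_neq0 pxe); rewrite expf_eq0 e0.
have [u v Euv _] := egcdnP p e0.
move: Euv; rewrite gcdnC (eqP (_ : coprime p e)) ?prime_coprime // => Euv.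
apply: (@perfect_power_cancel p x (x ^+ v)) => //; first by rewrite expf_neq0.
by rewrite -exprM -exprSr -addn1 -Euv mulnC exprM; apply: perfect_powerX.
Qed.

Lemma bezout_coprimez (u v x y : int) : u * x + v * y = 1 -> coprimez x y.
Proof.
move=> Euv; have : (gcdz x y %| 1%R)%Z.
  by rewrite -Euv rpredD // dvdz_mull // (dvdz_gcdl, dvdz_gcdr).
by rewrite dvdz1 /coprimez /gcdz absz_nat => /eqP ->.
Qed.

(** Both [x] and [x + 1] are nonzero, hence of the same sign, and distinct
    positive [p]-th powers are at distance more than one. *)
Lemma consecutive_perfect_powers p x : (1 < p)%N ->
  perfect_power p x -> perfect_power p (x + 1) -> False.
Proof.
move=> p1.
have gap j k : (0 < j)%N -> (j ^ p + 1 <> k ^ p)%N.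
  move=> j0 E; have lt_jk : (j < k)%N.
    by rewrite -(@ltn_exp2r _ _ p) ?(ltnW p1) // -E addn1.
  have : (j.+1 ^ p <= k ^ p)%N by rewrite leq_exp2r ?(ltnW p1).
  rewrite -E; case: p p1 {E lt_jk} => [|[|p]] // _.
  have := leq_exp2r j j.+1 (ltn0Sn p); rewrite leqnSn.
  have : (1 < j.+1 ^ p.+1)%N by rewrite -(exp1n p.+1) ltn_exp2r.
  by rewrite !(expnS _ p.+1); nia.
move=> [j j0 Ej] [k k0 Ek].
have [x0|x0] := leP 0 x.
  by apply: (@gap j k j0); rewrite -Ej -Ek; lia.
have : (0 < k ^ p)%N by rewrite expn_gt0 k0.
by move=> ?; apply: (@gap k j k0); rewrite -Ej -Ek; lia.
Qed.

(** * Simultaneous squares and cubes *)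

Section SumsOfSquares.
Local Open Scope nat_scope.

Lemma coprimenDl m n : coprime m (m + n) = coprime m n.
Proof. by rewrite /coprime gcdnDl. Qed.

Lemma coprimenDr m n : coprime m (n + m) = coprime m n.
Proof. by rewrite /coprime gcdnDr. Qed.

Lemma odd_gap m n : odd m -> odd n -> m <= n -> exists d, n = m + d.*2.
Proof.
move=> om on le_mn; exists (n - m)./2.
by rewrite halfK oddB // om on subn0 subnKC.
Qed.

Lemma coprime_square_mul x y k : coprime x y -> x * y = k ^ 2 ->
  exists r t, [/\ x = r ^ 2, y = t ^ 2 & k = r * t].
Proof.
move=> cop Exy; exists (gcdn x k), (gcdn y k).
have Ex := coprime_power_nat (isT : 0 < 2) cop Exy.
have Ey : y = gcdn y k ^ 2.
  by apply: (@coprime_power_nat 2 y x) => //; rewrite (coprime_sym, mulnC).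
split=> //; apply/eqP; rewrite -(@eqn_exp2r _ _ 2) // expnMn -Ex -Ey.
by rewrite Exy.
Qed.

(** The even leg is twice a square, the odd one a square. *)
Lemma legs_of_square_area s U V : coprime U V -> U * V = 2 * s ^ 2 ->
  exists p q, [/\ odd p, coprime p q, s = p * q
                & U ^ 2 + V ^ 2 = p ^ 4 + 4 * q ^ 4].
Proof.
wlog /dvdnP[W EU] : U V / 2 %| U => [wlg cop E|].
  have : 2 %| U * V by rewrite E dvdn_mulr.
  rewrite Euclid_dvdM // => /orP[d|d]; first exact: wlg.
  by rewrite addnC; apply: wlg; rewrite // (coprime_sym, mulnC).
rewrite {}EU coprimeMl => /andP[copWV cop2V] E.
have {}E : W * V = s ^ 2 by lia.
have [q [p [EW EV Es]]] := coprime_square_mul copWV E.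
exists p, q; split; last by rewrite EW EV; lia.
- by move: cop2V; rewrite EV coprime_pexpr // coprime2n.
- by rewrite coprime_sym; move: copWV; rewrite EW EV coprime_pexpl // coprime_pexpr.
- by rewrite Es mulnC.
Qed.

(** Fermat's theorem that the area [s ^ 2] of a Pythagorean triangle is not a
    nonzero square, by infinite descent.  The legs are [p ^ 2] and [2 q ^ 2], so
    [p ^ 4 + 4 q ^ 4] is a square [R ^ 2], and the two coprime factors
    [(R - p ^ 2) / 2] and [(R + p ^ 2) / 2] of [q ^ 4] are fourth powers
    [S ^ 4] and [R' ^ 4].  Hence [p ^ 2 = R' ^ 4 - S ^ 4] splits into the coprime
    squares [v ^ 2 = R' ^ 2 - S ^ 2] and [u ^ 2 = R' ^ 2 + S ^ 2], and
    [(u - v) / 2], [(u + v) / 2] are the legs of a smaller triangle, with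
    hypotenuse [R'] and area [(S / 2) ^ 2]. *)
Theorem no_square_area s U V R :
  coprime U V -> U * V = 2 * s ^ 2 -> U ^ 2 + V ^ 2 = R ^ 2 -> s = 0.
Proof.
elim/ltn_ind: s U V R => s IH U V R cop EUV.
have [p [q [odp coppq Es ->]]] := legs_of_square_area cop EUV.
move=> ER; have [//|s0] := posnP s.
have [p0 q0] : 0 < p /\ 0 < q by lia.
have p20 : 0 < p ^ 2 by rewrite expn_gt0 p0.
have q40 : 0 < q ^ 4 by rewrite expn_gt0 q0.
have Ep4 : p ^ 4 = p ^ 2 * p ^ 2 by rewrite -expnD.
have odR : odd R.
  have : odd (R ^ 2) by rewrite -ER oddD oddM !oddX odp.
  by rewrite oddX.
have lt_pR : p ^ 2 < R by rewrite -(@ltn_exp2r _ _ 2) // -ER; nia.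
have [X EX] : exists X, R = p ^ 2 + X.*2.
  by apply: odd_gap _ odR (ltnW lt_pR); rewrite oddX odp.
have {ER} EX4 : X * (X + p ^ 2) = q ^ 4 by move: ER; rewrite EX Ep4; lia.
have copX : coprime X (X + p ^ 2).
  rewrite coprimenDl coprimeXr //.
  apply: (@coprime_dvdl _ (q ^ 4)); first by rewrite -EX4 dvdn_mulr.
  by rewrite coprime_sym coprimeXr.
have [S2 [R2 [ES2 ER2 Eq2]]] : exists r t,
  [/\ X = r ^ 2, X + p ^ 2 = t ^ 2 & q ^ 2 = r * t].
  by apply: coprime_square_mul; rewrite // EX4 -expnM.
have copS : coprime S2 R2.
  by move: copX; rewrite ER2 ES2 coprime_pexpl // coprime_pexpr.
have [S [R' [ES ER Eq]]] := coprime_square_mul copS (esym Eq2).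
have {copS} copS : coprime S R'.
  by move: copS; rewrite ER ES coprime_pexpl // coprime_pexpr.
have S0 : 0 < S by move: q0; rewrite Eq; lia.
have R0 : 0 < R' by move: q0; rewrite Eq; lia.
have lt_SR : S2 < R2.
  by rewrite -(@ltn_exp2r _ _ 2) // -ER2 ES2; lia.
have [D ED] : exists D, R2 = D + S2 by exists (R2 - S2); lia.
have EDp : D * (D + 2 * S2) = p ^ 2 by move: ER2; rewrite ES2 ED; nia.
have odD : odd D.
  have : odd (D * (D + 2 * S2)) by rewrite EDp oddX odp orbT.
  by rewrite oddM => /andP[].
have copD : coprime D (D + 2 * S2).
  rewrite coprimenDl coprimeMr coprimen2 odD /=.
  by rewrite coprime_sym -coprimenDr -ED ES ER coprimeXl // coprimeXr.
have [v [u [Ev Eu _]]] := coprime_square_mul copD EDp.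
have odv : odd v by move: odD; rewrite Ev oddX.
have odu : odd u.
  have : odd (u ^ 2) by rewrite -Eu oddD oddM odD.
  by rewrite oddX.
have lt_vu : v < u.
  by rewrite -(@ltn_exp2r _ _ 2) // -Ev -Eu; move: lt_SR; rewrite ED; lia.
have [A EA] := odd_gap odv odu (ltnW lt_vu).
have ES' : S ^ 2 = 2 * (A * (v + A)) by rewrite -ES; move: Eu; rewrite Ev EA; clear; lia.
have [s' Es'] : exists s', S = 2 * s'.
  have : 2 %| S ^ 2 by rewrite ES' dvdn_mulr.
  by rewrite Euclid_dvdX // => /andP[/dvdnP[t ->] _]; exists t; rewrite mulnC.
have s'0 : s' = 0; last by move: S0; rewrite Es' s'0.
apply: (IH _ _ A (v + A) R').
- rewrite Es Eq Es' (_ : p * _ = s' * (2 * (p * R'))); last by clear; lia.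
  by rewrite ltn_Pmulr ?mul2n -?addnn ?addn_gt0 //; clear -p0 R0 S0 Es'; nia.
- rewrite coprimenDr.
  have : coprime v u by move: copD; rewrite Eu Ev coprime_pexpl // coprime_pexpr.
  by rewrite EA coprimenDl -muln2 coprimeMr coprime_sym => /andP[].
- by move: ES'; rewrite Es'; clear; lia.
- by rewrite -ER ED ES ES' Ev; clear; lia.
Qed.

(** The numbers [(u - t) / 2] and [(u + t) / 2] are the legs of a Pythagorean
    triangle of area [((t ^ 2 - 1) / 4) ^ 2]. *)
Theorem fourth_power_twice_square t u : t ^ 4 + 1 = 2 * u ^ 2 -> t = 1.
Proof.
move=> Etu.
have odt : odd t.
  have : odd (t ^ 4) by lia.
  by rewrite oddX.
have [d Ed] : exists d, t = d.*2.+1 by exists t./2; lia.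
have [d0|d0] := posnP d; first by rewrite Ed d0.
have e0 : 0 < d * d.+1 by rewrite muln_gt0 d0.
(* [e = (t ^ 2 - 1) / 4] is the square root of the area. *)
set e := d * d.+1 in e0.
have Et2 : t ^ 2 = 4 * e + 1 by rewrite Ed /e; clear; lia.
have Eu2 : u ^ 2 = 8 * e ^ 2 + 4 * e + 1.
  by move: Etu; rewrite (expnM t 2 2 : t ^ 4 = _) Et2; clear; lia.
have odu : odd u.
  have : odd (u ^ 2) by rewrite Eu2 oddD oddD !oddM.
  by rewrite oddX.
have lt_tu : t < u by rewrite -(@ltn_exp2r _ _ 2) // Et2 Eu2; clear -e0; nia.
have [A EA] := odd_gap odt odu (ltnW lt_tu).
have copA : coprime A (t + A).
  rewrite coprimenDr coprime_sym.
  have : coprime (t ^ 4) (2 * u ^ 2) by rewrite -Etu addn1 coprimenS.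
  rewrite coprime_pexpl // coprimeMr coprime_pexpr // EA coprimenDl -muln2.
  by rewrite coprimeMr => /and3P[].
have EA2 : A * (t + A) = 2 * e ^ 2.
  have : u ^ 2 = t ^ 2 + 4 * (A * (t + A)) by rewrite EA; clear; lia.
  by rewrite Eu2 Et2; clear; lia.
suff : e = 0 by lia.
apply: (no_square_area copA EA2 (R := 2 * e + 1)).
transitivity (t ^ 2 + 2 * (A * (t + A))); first by clear; lia.
by rewrite EA2 Et2; clear; lia.
Qed.

End SumsOfSquares.

Lemma int_cube_lt (x y : int) : x ^+ 3 < y ^+ 3 -> x < y.
Proof.
apply: contraTT; rewrite -!leNgt -[y <= x]subr_ge0 -[y ^+ 3 <= _]subr_ge0.
move=> le_yx.
rewrite (_ : _ - _ = (x - y) * (x ^+ 2 + x * y + y ^+ 2)); last by ring.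
by apply: mulr_ge0 => //; have := sqr_ge0 (2 * x + y); have := sqr_ge0 y; lia.
Qed.

(** Linear comparisons between consecutive powers of [z], from which linear
    arithmetic derives the polynomial inequalities below. *)
Lemma monomial_growth (c z : int) : 0 <= c -> c <= z ->
  [/\ c * z <= z ^+ 2, c * z ^+ 2 <= z ^+ 3 & c * z ^+ 3 <= z ^+ 4].
Proof.
move=> c0 cz; have z0 := le_trans c0 cz.
by rewrite expr2 [z ^+ 3]exprS [z ^+ 4]exprS !ler_wpM2r // !mulr_ge0.
Qed.

Lemma cubeN (x : int) : (- x) ^+ 3 = - x ^+ 3.
Proof. by ring. Qed.

Lemma is_cube_int x : perfect_power 3 x -> exists y : int, x = y ^+ 3.
Proof. by rewrite -is_cubeE => -[y _ /intr_inj]; exists y. Qed.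

(** For [x] different from [0] and [1] the value lies strictly between the
    squares of two consecutive integers. *)
Lemma square_conic (x : int) :
  perfect_power 2 (x ^+ 2 - x + 1) -> x = 0 \/ x = 1.
Proof.
move=> [k k0 Ek]; have {}Ek : x ^+ 2 - x + 1 = k%:Z ^+ 2 by nia.
have [x2|x2] := leP 2 x.
  by have [?|?] := leP k%:Z (x - 1); nia.
have [x1|x1] := leP x (-1); last by lia.
by have [?|?] := leP k%:Z (- x); nia.
Qed.

(** If [x = y ^ 3 + 1], then [x ^ 2 - 3 x + 1 = y ^ 6 - y ^ 3 - 1] lies strictly
    between the cubes of [y ^ 2] and of a neighbour, except for [y = 1], which
    [2 x - 1 = 3] excludes. *)
Lemma no_cubes_zeta (x : int) : x != 0 -> x != 1 ->
  perfect_power 3 (x - 1) -> perfect_power 3 (2 * x - 1) ->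
  perfect_power 3 (- x ^+ 2 + 3 * x - 1) -> False.
Proof.
move=> x0 x1 /is_cube_int[y Ey] /is_cube_int[v Ev] /is_cube_int[w Ew].
have Ex : x = y ^+ 3 + 1 by rewrite -Ey; ring.
have Ew3 : (- w) ^+ 3 = (y ^+ 2) ^+ 3 - y ^+ 3 - 1.
  by rewrite cubeN -Ew Ex; ring.
have y0 : y != 0 by apply: contraNneq x1 => y0; rewrite Ex y0.
have yN1 : y != -1 by apply: contraNneq x0 => y1; rewrite Ex y1.
have [y1|y1] := eqVneq y 1.
  have Ev3 : v ^+ 3 = 3 by rewrite -Ev Ex y1.
  have : 1 < v by apply: int_cube_lt; rewrite Ev3.
  have : v < 2 by apply: int_cube_lt; rewrite Ev3.
  lia.
have [y2|y2] := leP 2 y.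
  have [_ hy2 hy3] := monomial_growth (ler0n _ 2) y2.
  have : - w < y ^+ 2 by apply: int_cube_lt; rewrite Ew3; lia.
  have : y ^+ 2 - 1 < - w by apply: int_cube_lt; rewrite Ew3; lia.
  by lia.
have [z2 Ez] : 2 <= - y /\ y = - - y by lia.
move: (- y) z2 Ez => z z2 Ez; rewrite {y y0 yN1 y1 y2 Ey Ex}Ez in Ew3.
have [hz1 hz2 hz3] := monomial_growth (ler0n _ 2) z2.
have : - w < z ^+ 2 + 1 by apply: int_cube_lt; rewrite Ew3; lia.
have : z ^+ 2 < - w by apply: int_cube_lt; rewrite Ew3; lia.
by lia.
Qed.

(** If [x = y ^ 3] and [2 x - 1 = v ^ 3], then the third number is, up to sign,
    [(y v) ^ 3 - (y ^ 3 - 1)], and the error term [y ^ 3 - 1] is too small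
    compared with [(y v) ^ 2] to reach another cube. *)
Lemma no_cubes_theta (x : int) : x != 0 -> x != 1 ->
  perfect_power 3 x -> perfect_power 3 (2 * x - 1) ->
  perfect_power 3 (2 * x - 2 * x ^+ 2 - 1) -> False.
Proof.
move=> x0 x1 /is_cube_int[y Ey] /is_cube_int[v Ev] /is_cube_int[w Ew].
have y0 : y != 0 by apply: contraNneq x0 => y0; rewrite Ey y0.
have y1 : y != 1 by apply: contraNneq x1 => y1; rewrite Ey y1.
set P := y * v; have EP : P ^+ 3 = 2 * (y ^+ 3) ^+ 2 - y ^+ 3.
  by rewrite /P exprMn -Ev Ey; ring.
have EW : (- w) ^+ 3 = P ^+ 3 - (y ^+ 3 - 1).
  by rewrite cubeN -Ew EP Ey; ring.
have [y2|y2] := leP 2 y.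
  have [h1 h2 h3] := monomial_growth (ler0n _ 2) y2.
  have y3 : 2 <= y ^+ 3 by lia.
  have [h4 _ _] := monomial_growth (ler0n _ 2) y3.
  have lt_P : y ^+ 2 < P by apply: int_cube_lt; rewrite EP; lia.
  have [|h5 _ _] := @monomial_growth 4 P (ler0n _ 4); first by lia.
  have h6 : y ^+ 2 * y ^+ 2 <= P * P by apply: ler_pM; lia.
  have : - w < P by apply: int_cube_lt; rewrite EW; lia.
  have : P - 1 < - w by apply: int_cube_lt; rewrite EW; lia.
  by lia.
have [z1 Ez] : 1 <= - y /\ y = - - y by lia.
move: (- y) z1 Ez => z z1 Ez; rewrite {}Ez (cubeN z) in EP EW.
have [h1 h2 h3] := monomial_growth (ler0n _ 1) z1.
have lt_P : z ^+ 2 < P by apply: int_cube_lt; rewrite EP; lia.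
have h6 : z ^+ 2 * z ^+ 2 <= P * P by apply: ler_pM; lia.
have : P < - w by apply: int_cube_lt; rewrite EW; lia.
have : - w < P + 1 by apply: int_cube_lt; rewrite EW; lia.
by lia.
Qed.

(** The cofactor [u ^ 2 - u v + v ^ 2] is congruent to [- 3 u v] modulo
    [u + v]. *)
Lemma coprime_sum_of_cubes (u v w : int) :
  coprimez u v -> ~~ (3 %| u + v)%Z -> w != 0 -> u ^+ 3 + v ^+ 3 = w ^+ 3 ->
  perfect_power 3 (u + v).
Proof.
move=> copuv not3 w0 Ew.
apply: (@coprime_perfect_power 3 _ (u ^+ 2 - u * v + v ^+ 2)) => //; last first.
  rewrite (_ : _ * _ = w ^+ 3); first exact: perfect_power_exp.
  by rewrite -Ew; ring.
rewrite (_ : _ + v ^+ 2 = (u + v) * (u + v) + (- 3) * (u * v)); last by ring.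
rewrite /coprimez gcdzMDl -/(coprimez _ _) !coprimezMr.
apply/and3P; split.
- by rewrite coprimezE coprime_sym prime_coprime.
- by rewrite coprimez_sym /coprimez gcdzDl.
- by rewrite coprimez_sym /coprimez gcdzDr -/(coprimez _ _) coprimez_sym.
Qed.

(** The second number is [x ^ 3 - (x - 1) ^ 3], so this is a case of Fermat's
    theorem for cubes; the extra condition [x = y ^ 3] allows an elementary
    proof.  With [z] the cube root of the second number,
    [(x - 1) ^ 3 + z ^ 3] and [x ^ 3 - z ^ 3] are cubes.  As [z] is [1] modulo
    [3], one of [x - 1 + z], [x - z] is prime to [3], and it is then a cube by
    [coprime_sum_of_cubes].  But both differ from [y ^ 3] by about
    [3 ^ (1 / 3) y ^ 2], too little to reach another cube. *)
Lemma no_cubes_difference (x : int) : x != 0 -> x != 1 ->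
  perfect_power 3 x -> perfect_power 3 (3 * x ^+ 2 - 3 * x + 1) -> False.
Proof.
move=> x0 x1; have x_gt : 0 < x * (x - 1) by nia.
move=> /is_cube_int[y Ey] /is_cube_int[z Ez].
have y0 : y != 0 by apply: contraNneq x0 => y0; rewrite Ey y0.
have y1 : y != 1 by apply: contraNneq x1 => y1; rewrite Ey y1.
have [q Eq] : exists q, z = 3 * q + 1.
  exists (z %/ 3)%Z.
  have : z = 3 * (z %/ 3)%Z + (z %% 3)%Z by lia.
  move: (z %/ 3)%Z => q; have : (z %% 3)%Z \in [:: 0; 1; 2] by rewrite !inE; lia.
  rewrite !inE => /or3P[] /eqP -> // Eq; rewrite Eq in Ez; lia.
have z_gt1 : 1 < z by apply: int_cube_lt; rewrite -Ez expr1n; lia.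
(* [z] is about [3 ^ (1 / 3) y ^ 2]. *)
have z_bound : if 0 < y then 2 * z < 3 * y ^+ 2 else z < 2 * y ^+ 2.
  case: ifP => y_gt; apply: int_cube_lt.
    have y2 : 2 <= y by lia.
    have [h1 h2 h3] := monomial_growth (ler0n _ 2) y2.
    have y3 : 2 <= y ^+ 3 by lia.
    have [h4 _ _] := monomial_growth (ler0n _ 2) y3.
    by rewrite exprMn -Ez Ey; lia.
  have y_le : 1 <= - y by lia.
  have [h1 h2 h3] := monomial_growth (ler0n _ 1) y_le.
  have y3 : 1 <= (- y) ^+ 3 by lia.
  have [h4 _ _] := monomial_growth (ler0n _ 1) y3.
  by rewrite -Ez Ey; lia.
have [x_mod|x_mod] := boolP (3 %| x - 1)%Z.
  have [k Ek] : exists k, x - 1 + z = k ^+ 3.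
    apply/is_cube_int/(@coprime_sum_of_cubes _ _ x) => //; last by rewrite -Ez; ring.
      by apply: (@bezout_coprimez (- 3 * x) (z ^+ 2)); rewrite -exprSr -Ez; ring.
    by rewrite Eq; lia.
  have : y < k by apply: int_cube_lt; rewrite -Ek Ey; lia.
  have : k < y + 1; last by lia.
  apply: int_cube_lt; rewrite -Ek Ey.
  case: ifP z_bound => y_gt z_bound.
    have y2 : 2 <= y by lia.
    by have [? _ _] := monomial_growth (ler0n _ 2) y2; lia.
  have y_le : 2 <= - y.
    have : y != -1 by apply: contraTneq x_mod => yN1; rewrite Ey yN1.
    lia.
  have : 0 <= (- y - 2) * (- y - 1) by apply: mulr_ge0; lia.
  by lia.
have [k Ek] : exists k, x - z = k ^+ 3.
  apply/is_cube_int/(@coprime_sum_of_cubes _ _ (x - 1)).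
  - by apply: (@bezout_coprimez (3 - 3 * x) (- z ^+ 2)); rewrite mulrNN -exprSr -Ez; ring.
  - by rewrite Eq; lia.
  - by rewrite subr_eq0.
  - by rewrite cubeN -Ez; ring.
have : k < y by apply: int_cube_lt; rewrite -Ek Ey; lia.
have : y - 1 < k; last by lia.
apply: int_cube_lt; rewrite -Ek Ey.
case: ifP z_bound => y_gt z_bound; last by lia.
have y2 : 2 <= y by lia.
by have [? _ _] := monomial_growth (ler0n _ 2) y2; lia.
Qed.

(** The second number is [- ((2 x - 1) ^ 2 + 1) / 2]. *)
Lemma no_squares_theta (x : int) : x != 0 -> x != 1 ->
  perfect_power 2 (2 * x - 1) -> perfect_power 2 (2 * x - 2 * x ^+ 2 - 1) ->
  False.
Proof.
move=> x0 x1 [t t0 Et] [u u0 Eu].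
have t1 : (t = 1)%N.
  apply: (@fourth_power_twice_square t u).
  rewrite -Eu (expnM t 2 2 : t ^ 4 = _)%N -Et; nia.
by move: Et; rewrite t1; lia.
Qed.

(** * Polynomial identities between monomials *)

(** Coefficients in order of increasing degree.  Unlike [{poly int}], these
    lists compute. *)
Definition poly_list := seq int.

Definition peval (x : int) (p : poly_list) : int :=
  foldr (fun c v => c + x * v) 0 p.

Fixpoint padd (p q : poly_list) : poly_list :=
  match p, q with
  | [::], _ => q
  | _, [::] => p
  | c :: p', d :: q' => c + d :: padd p' q'
  end.

Definition pscale (c : int) (p : poly_list) : poly_list := map ( *%R c) p.

Definition pmul (p q : poly_list) : poly_list :=
  foldr (fun c r => padd (pscale c q) (0 :: r)) [::] p.

Definition pexp (p : poly_list) (n : nat) : poly_list := iter n (pmul p) [:: 1].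

Section PolyEval.
Variable x : int.

Lemma peval_add p q : peval x (padd p q) = peval x p + peval x q.
Proof.
elim: p q => [|c p IHp] [|d q] /=; rewrite ?add0r ?addr0 //.
by rewrite IHp; ring.
Qed.

Lemma peval_scale c p : peval x (pscale c p) = c * peval x p.
Proof. by elim: p => [|d p /= ->]; rewrite ?mulr0 //; ring. Qed.

Lemma peval_mul p q : peval x (pmul p q) = peval x p * peval x q.
Proof.
elim: p => [|c p IHp]; first by rewrite mul0r.
by rewrite /= peval_add peval_scale /= IHp; ring.
Qed.

Lemma peval_exp p n : peval x (pexp p n) = peval x p ^+ n.
Proof.
by elim: n => [|n IHn] /=; rewrite ?peval_mul ?IHn ?exprS // mulr0 addr0.
Qed.

Lemma peval_zero p : all (eq_op^~ 0) p -> peval x p = 0.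
Proof. by elim: p => //= c p IHp /andP[/eqP-> /IHp ->]; rewrite mulr0. Qed.

End PolyEval.

(** The monomial [(c, e)] stands for [c * \prod_i f_i ^ e_i], where the factors
    [f_i] are fixed polynomials in [x]. *)
Definition mono := (int * seq nat)%type.

Lemma nth_scale n (l : seq nat) i : nth 0%N [seq n * d | d <- l]%N i = (n * nth 0 l i)%N.
Proof.
have [ltil|leil] := ltnP i (size l); first by rewrite (nth_map 0%N).
by rewrite !nth_default ?size_map // muln0.
Qed.

Section Monomials.

Variables (fs : seq poly_list).
Let k := size fs.

Definition eadd (e1 e2 : seq nat) := mkseq (fun i => nth 0 e1 i + nth 0 e2 i)%N k.
Definition esub (e1 e2 : seq nat) := mkseq (fun i => nth 0 e1 i - nth 0 e2 i)%N k.
Definition emin (e1 e2 : seq nat) := mkseq (fun i => minn (nth 0 e1 i) (nth 0 e2 i))%N k.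

Definition mmul (m1 m2 : mono) : mono := (m1.1 * m2.1, eadd m1.2 m2.2).
Definition mexp (m : mono) (n : nat) : mono := (m.1 ^+ n, [seq n * d | d <- m.2]%N).

Definition mono_poly (m : mono) : poly_list :=
  foldr (fun i => pmul (pexp (nth [::] fs i) (nth 0%N m.2 i))) [:: m.1] (iota 0 k).

(** Tests that the sum of the products [t.1 * t.2] expands to zero.  Terms with zero
    coefficient are dropped first, since their exponents would spoil the common
    factor [g]. *)
Definition vanish (ts : seq (poly_list * mono)) : bool :=
  let us := [seq t <- ts | t.2.1 != 0] in
  let g := foldr (fun t => emin t.2.2) (head ([::], (0, [::])) us).2.2 us in
  all (fun t => eadd g (esub t.2.2 g) == t.2.2) us &&
  all (eq_op^~ 0)
    (foldr (fun t => padd (pmul t.1 (mono_poly (t.2.1, esub t.2.2 g)))) [::] us).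

Variables (x : int) (F : seq int).
Hypothesis FE : F = [seq peval x f | f <- fs].

Definition mval (m : mono) : int := m.1 * \prod_(i < k) F`_i ^+ nth 0%N m.2 i.

Lemma mval_mul m1 m2 : mval (mmul m1 m2) = mval m1 * mval m2.
Proof.
rewrite /mval mulrACA -big_split /=; congr (_ * _).
by apply: eq_bigr => i _; rewrite nth_mkseq // exprD.
Qed.

Lemma mval_exp m n : mval (mexp m n) = mval m ^+ n.
Proof.
rewrite /mval exprMn -prodrXl; congr (_ * _); apply: eq_bigr => i _ /=.
by rewrite nth_scale -exprM mulnC.
Qed.

Lemma mvalE m : mval m =
  m.1 * foldr (fun i z => F`_i ^+ nth 0%N m.2 i * z) 1 (iota 0 k).
Proof.
rewrite /mval -(big_mkord xpredT (fun i => F`_i ^+ nth 0%N m.2 i)).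
rewrite /index_iota subn0; congr (_ * _).
by elim: (iota 0 k) => [|i s /= <-]; rewrite ?big_nil ?big_cons.
Qed.

Lemma mval0 m : m.1 = 0 -> mval m = 0.
Proof. by rewrite /mval => ->; rewrite mul0r. Qed.

Lemma peval_mono m : peval x (mono_poly m) = mval m.
Proof.
rewrite /mono_poly /mval -(big_mkord xpredT (fun i => F`_i ^+ nth 0%N m.2 i)).
rewrite /index_iota subn0.
have : all (gtn k) (iota 0 k) by apply/allP => i; rewrite mem_iota.
elim: (iota 0 k) => [_|i s IHs /= /andP[lti lts]].
  by rewrite big_nil /= mulr0 addr0 mulr1.
rewrite big_cons peval_mul peval_exp IHs // mulrCA FE (nth_map [::]) //.
Qed.

(** Dividing all terms by the common factor [g] leaves a polynomial identity of
    small degree, which is decided by expanding it. *)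
Lemma vanishP ts : vanish ts -> \sum_(t <- ts) peval x t.1 * mval t.2 = 0.
Proof.
move=> /andP[]; set us := filter _ ts; set g := foldr _ _ us.
move=> allg /(peval_zero x).
have -> : \sum_(t <- ts) peval x t.1 * mval t.2
        = \sum_(t <- us) peval x t.1 * mval t.2.
  rewrite big_filter [LHS](bigID (fun t => t.2.1 != 0)) /= [X in _ + X]big1 ?addr0 //.
  by move=> t; rewrite negbK => /eqP t0; rewrite mval0 ?mulr0.
suff -> : \sum_(t <- us) peval x t.1 * mval t.2 = mval (1, g) * peval x
    (foldr (fun t => padd (pmul t.1 (mono_poly (t.2.1, esub t.2.2 g)))) [::] us).
  by move=> ->; rewrite mulr0.
clearbody g us; elim: us allg => [_|t us IHus /= /andP[/eqP Eg allg]].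
  by rewrite big_nil mulr0.
rewrite big_cons IHus // peval_add peval_mul peval_mono mulrDr.
by congr (_ + _); rewrite [RHS]mulrCA -mval_mul /mmul /= mul1r Eg -surjective_pairing.
Qed.

End Monomials.

(** * Division polynomials at the origin *)

Definition ev0 (p : polyxy) : rat := evalxy p 0 0.

Lemma ev0D p q : ev0 (p + q) = ev0 p + ev0 q.
Proof. by rewrite /ev0 /evalxy !hornerD. Qed.

Lemma ev0N p : ev0 (- p) = - ev0 p.
Proof. by rewrite /ev0 /evalxy !hornerN. Qed.

Lemma ev0M p q : ev0 (p * q) = ev0 p * ev0 q.
Proof. by rewrite /ev0 /evalxy !hornerM. Qed.

Lemma ev0X p n : ev0 (p ^+ n) = ev0 p ^+ n.
Proof. by rewrite /ev0 /evalxy !horner_exp. Qed.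

Lemma ev0_int (z : int) : ev0 z%:~R = z%:~R.
Proof. by rewrite /ev0 /evalxy -!(rmorph_int polyC) !hornerC. Qed.

Lemma ev0_nat n : ev0 n%:R = n%:R.
Proof. by rewrite pmulrn (ev0_int n) -pmulrn. Qed.

Lemma ev0_x : ev0 vx = 0.
Proof. by rewrite /ev0 /evalxy /vx hornerC hornerX. Qed.

Lemma ev0_y : ev0 vy = 0.
Proof. by rewrite /ev0 /evalxy /vy hornerX hornerC. Qed.

Definition ev0E := (ev0D, ev0N, ev0M, ev0X, ev0_int, ev0_nat, ev0_x, ev0_y).

Section DivisionValues.

Variables (E : weierstrass) (W H : nat -> int).
Hypotheses (a4 : wa4 E = 0) (a6 : wa6 E = 0).
Hypotheses (W0 : W 0 = 0) (W1 : W 1 = 1).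
Hypotheses (W2 : W 2 = wa3 E) (W2_neq0 : W 2 != 0).
Hypotheses (W3 : W 3 = wa2 E * W 2 ^+ 2).
Hypotheses (W4 : W 4 = W 2 ^+ 4 * (wa1 E * wa2 E - W 2)).
Hypotheses (Wodd : forall m,
  W m.*2.+3 = W m.+3 * W m.+1 ^+ 3 - W m * W m.+2 ^+ 3).
Hypotheses (Weven : forall m,
  W m.*2.+4 * W 2 = W m.+1 ^+ 2 * W m.+2 * W m.+4 - W m * W m.+2 * W m.+3 ^+ 2).
Hypotheses (H0 : H 0 = 1) (H1 : H 1 = 0).
Hypotheses (HE : forall m, 2 * W 2 * H m.+2 =
  W m.+1 ^+ 2 * W m.+4 - W m * W m.+3 ^+ 2
  + W 2 * W m.+2 * (wa1 E * W m.+3 * W m.+1 - W 2 * W m.+2 ^+ 2)).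

Lemma psi2_val : ev0 (psi2 E) = (W 2)%:~R.
Proof. by rewrite /psi2 -?[2]/(2%:R) !ev0E W2 !mulr0 !add0r. Qed.

(** The recursion determines the sequence because [psi_2(P)] is not zero. *)
Lemma psi_val n : ev0 (psi E n) = (W n)%:~R.
Proof.
elim/ltn_ind: n => n IH.
have [n5|n5] := ltnP n 5.
  case: n n5 {IH} => [|[|[|[|[|n]]]]] // _.
  - by rewrite W0 (ev0_int 0).
  - by rewrite W1 (ev0_int 1).
  - exact: psi2_val.
  - rewrite [psi E 3]/(psi3 E) /psi3 a4 a6 W3 W2.
    by rewrite -?[2]/(2%:R) -?[3]/(3%:R) -?[4]/(4%:R) !ev0E; ring.
  - rewrite [psi E 4]/(psi4 E) /psi4 a4 a6 W4 ev0M psi2_val W2.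
    by rewrite -?[2]/(2%:R) -?[5]/(5%:R) -?[10]/(10%:R) -?[4]/(4%:R) !ev0E; ring.
have [odn|evn] := boolP (odd n).
  have [m En] : exists m, n = m.*2.+3 by exists (n./2).-1; lia.
  rewrite {}En in IH n5 *; have m1 : (0 < m)%N by lia.
  rewrite Wodd (@psi_odd E m.+1) // !ev0E !IH //; try lia.
  by ring.
have [m En] : exists m, n = m.*2.+4 by exists (n./2).-2; lia.
rewrite {}En in IH n5 *; have m1 : (0 < m)%N by lia.
apply: (@mulIf _ (W 2)%:~R); first by rewrite intr_eq0.
rewrite -rmorphM Weven -psi2_val -ev0M (@psi_even E m.+2) // !ev0E !IH //; try lia.
by ring.
Qed.

Lemma Hnum_val n : Hnum E n = (H n)%:~R.
Proof.
case: n => [|[|m]].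
- by rewrite H0 -[LHS]/(ev0 1) (ev0_int 1).
- by rewrite H1 -[LHS]/(ev0 vy) ev0_y.
apply: (@mulIf _ (2 * (W 2)%:~R)).
  by rewrite mulf_neq0 ?intr_eq0.
rewrite -[Hnum E m.+2]/(ev0 (omega E m.+2)) -psi2_val.
have -> : ev0 (omega E m.+2) * (2 * ev0 (psi2 E))
        = ev0 (omega E m.+2 * (2 * psi2 E)).
  by rewrite -[2 in RHS]/(2%:R) !ev0E.
rewrite omega_ge2 // /phi !ev0E !psi_val ?psi2_val -?W2 /=.
transitivity ((2 * W 2 * H m.+2)%:~R : rat); last by ring.
by rewrite HE; ring.
Qed.

End DivisionValues.

(** * Quasi-periodic solutions of the recursions *)

(** The values at [P] of a family of curves on which [P] has order
    [torsion_order], as polynomials in the parameter: [a1] is a coefficient list,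
    the other values are monomials in [factors].  The tables list [psi_r(P)] and
    [omega_r(P)] for [r] below the order, and [step_a], [step_b] are the
    monomials [a], [b] such that [psi_(n + N) = a * b ^ n * psi_n]. *)
Record torsion_data := TorsionData {
  torsion_order : nat;
  factors : seq poly_list;
  curve_a1 : poly_list;
  curve_a2 : mono;
  step_a : mono;
  step_b : mono;
  psi_tab : seq mono;
  omega_tab : seq mono }.

Section Recursions.

Variables (fs : seq poly_list) (w h : nat -> mono) (c1 : poly_list) (m2 : mono).

Local Notation "x * y" := (mmul fs x y) : mono_scope.
Local Notation "x ^ n" := (mexp x n) : mono_scope.
Delimit Scope mono_scope with M.

(** These lists are the differences of the two sides of the formulas that define
    [psi_(2 m + 3)], [psi_(2 m + 4)], [omega_(m + 2)], [psi_3] and [psi_4] at a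
    point with [x = y = 0]. *)
Definition odd_terms (m : nat) : seq (poly_list * mono) :=
  [:: ([:: 1], w m.*2.+3); ([:: -1], (w m.+3 * w m.+1 ^ 3)%M);
      ([:: 1], (w m * w m.+2 ^ 3)%M)].

Definition even_terms (m : nat) : seq (poly_list * mono) :=
  [:: ([:: 1], (w m.*2.+4 * w 2)%M);
      ([:: -1], (w m.+1 ^ 2 * w m.+2 * w m.+4)%M);
      ([:: 1], (w m * w m.+2 * w m.+3 ^ 2)%M)].

Definition omega_terms (m : nat) : seq (poly_list * mono) :=
  [:: ([:: 2], (w 2 * h m.+2)%M); ([:: -1], (w m.+1 ^ 2 * w m.+4)%M);
      ([:: 1], (w m * w m.+3 ^ 2)%M);
      (pscale (-1) c1, (w 2 * w m.+2 * w m.+3 * w m.+1)%M);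
      ([:: 1], (w 2 ^ 2 * w m.+2 ^ 3)%M)].

Definition psi3_terms : seq (poly_list * mono) :=
  [:: ([:: 1], w 3); ([:: -1], (m2 * w 2 ^ 2)%M)].

Definition psi4_terms : seq (poly_list * mono) :=
  [:: ([:: 1], w 4); (pscale (-1) c1, (m2 * w 2 ^ 4)%M); ([:: 1], (w 2 ^ 5)%M)].

Variables (x : int) (F : seq int).
Hypothesis FE : F = [seq peval x f | f <- fs].
Let Wv n := mval fs F (w n).
Let Hv n := mval fs F (h n).

Let solve (u v t : int) : t = 0 -> t = u - v -> u = v.
Proof. by move=> -> /esym/eqP; rewrite subr_eq0 => /eqP. Qed.

Let sumE := (big_cons, big_nil, mval_mul, mval_exp, peval_scale).

Lemma odd_termsP m : vanish fs (odd_terms m) ->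
  Wv m.*2.+3 = Wv m.+3 * Wv m.+1 ^+ 3 - Wv m * Wv m.+2 ^+ 3.
Proof. by move/(vanishP FE)/solve; apply; rewrite !sumE /= /Wv; ring. Qed.

Lemma even_termsP m : vanish fs (even_terms m) -> Wv m.*2.+4 * Wv 2 =
  Wv m.+1 ^+ 2 * Wv m.+2 * Wv m.+4 - Wv m * Wv m.+2 * Wv m.+3 ^+ 2.
Proof. by move/(vanishP FE)/solve; apply; rewrite !sumE /= /Wv; ring. Qed.

Lemma omega_termsP m : vanish fs (omega_terms m) -> 2 * Wv 2 * Hv m.+2 =
  Wv m.+1 ^+ 2 * Wv m.+4 - Wv m * Wv m.+3 ^+ 2
  + Wv 2 * Wv m.+2 * (peval x c1 * Wv m.+3 * Wv m.+1 - Wv 2 * Wv m.+2 ^+ 2).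
Proof. by move/(vanishP FE)/solve; apply; rewrite !sumE /= /Wv /Hv; ring. Qed.

Lemma psi3_termsP : vanish fs psi3_terms -> Wv 3 = mval fs F m2 * Wv 2 ^+ 2.
Proof. by move/(vanishP FE)/solve; apply; rewrite !sumE /= /Wv; ring. Qed.

Lemma psi4_termsP : vanish fs psi4_terms ->
  Wv 4 = Wv 2 ^+ 4 * (peval x c1 * mval fs F m2 - Wv 2).
Proof. by move/(vanishP FE)/solve; apply; rewrite !sumE /= /Wv; ring. Qed.

End Recursions.

Section QuasiPeriodic.

Variable D : torsion_data.
Let N := torsion_order D.
Let fs := factors D.
Let a := step_a D.
Let b := step_b D.

(** With [b ^ N = a ^ 2], iterating [psi_(n + N) = a * b ^ n * psi_n] gives
    [psi_(q N + r) = a ^ (q ^ 2) * b ^ (q r) * psi_r]. *)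
Definition psi_mono (n : nat) : mono :=
  let q := (n %/ N)%N in let r := (n %% N)%N in
  mmul fs (mexp a (q * q)) (mmul fs (mexp b (q * r)) (nth (0, [::]) (psi_tab D) r)).

(** Every term of the formula for [omega_n] is cubic in the values of [psi] near
    [n], so that the factors are the cubes of those for [psi]. *)
Definition omega_mono (n : nat) : mono :=
  let q := (n %/ N)%N in let r := (n %% N)%N in
  mmul fs (mexp a (3 * (q * q)))
    (mmul fs (mexp b (3 * (q * r))) (nth (0, [::]) (omega_tab D) r)).

Local Notation W := psi_mono.
Local Notation H := omega_mono.

Definition one_mono (m : mono) : bool := (m.1 == 1) && all (eq_op^~ 0%N) m.2.

(** The recursions for one period; quasi-periodicity propagates them. *)
Definition valid : bool :=
  [&& (0 < N)%N,
      [&& mexp a 2 == mexp b N, (W 0).1 == 0, one_mono (W 1), one_mono (H 0)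
        & (H 1).1 == 0],
      vanish fs (psi3_terms fs W (curve_a2 D))
        && vanish fs (psi4_terms fs W (curve_a1 D) (curve_a2 D)) &
      all (fun m => [&& vanish fs (odd_terms fs W m), vanish fs (even_terms fs W m)
                      & vanish fs (omega_terms fs W H (curve_a1 D) m)]) (iota 0 N)].

Variables (x : int) (F : seq int).
Hypothesis FE : F = [seq peval x f | f <- fs].
Hypothesis validD : valid.

Let Wv n := mval fs F (W n).
Let Hv n := mval fs F (H n).
Let A := mval fs F a.
Let B := mval fs F b.

Lemma torsion_gt0 : (0 < N)%N.
Proof. by case/and4P: validD. Qed.

Lemma step_sqr : A ^+ 2 = B ^+ N.
Proof.
by rewrite -!mval_exp; case/and4P: validD => _ /andP[/eqP -> _] _ _.
Qed.

Lemma mval_one m : one_mono m -> mval fs F m = 1.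
Proof.
case/andP=> /eqP c1 /allP e0; rewrite /mval c1 mul1r big1 // => i _.
have [lti|lei] := ltnP i (size m.2); last by rewrite [nth _ m.2 _]nth_default.
by rewrite (eqP (e0 _ (mem_nth _ lti))).
Qed.

Lemma psi_mono_shift m : Wv (m + N) = A * B ^+ m * Wv m.
Proof.
rewrite /Wv /psi_mono !mval_mul !mval_exp -/A -/B divnDr // divnn torsion_gt0.
rewrite modnDr [in B ^+ m](divn_eq m N); set q := (m %/ N)%N; set r := (m %% N)%N.
rewrite (_ : (q + true) * (q + true) = 1 + 2 * q + q * q)%N; last by rewrite /=; lia.
rewrite (_ : (q + true) * r = r + q * r)%N; last by rewrite /=; lia.
rewrite !exprD [(q * N)%N]mulnC !exprM -step_sqr [A ^+ 2 ^+ q]exprAC.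
by ring.
Qed.

Lemma omega_mono_shift m : Hv (m + N) = A ^+ 3 * B ^+ m ^+ 3 * Hv m.
Proof.
rewrite /Hv /omega_mono !mval_mul !mval_exp -/A -/B divnDr // divnn torsion_gt0.
rewrite modnDr [in B ^+ m](divn_eq m N); set q := (m %/ N)%N; set r := (m %% N)%N.
rewrite (_ : (q + true) * (q + true) = 1 + 2 * q + q * q)%N; last by rewrite /=; lia.
rewrite (_ : (q + true) * r = r + q * r)%N; last by rewrite /=; lia.
rewrite ![(3 * _)%N]mulnC !exprM !exprD [(q * N)%N]mulnC !exprM -step_sqr.
rewrite [A ^+ 2 ^+ q]exprAC.
by ring.
Qed.

Lemma shift_ind (P : nat -> Prop) : (forall m, (m < N)%N -> P m) ->
  (forall m, P m -> P (m + N)%N) -> forall m, P m.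
Proof.
move=> P0 PN m; rewrite (divn_eq m N); elim: (m %/ N)%N => [|q IHq].
  by rewrite mul0n; apply: P0; rewrite ltn_mod torsion_gt0.
by rewrite mulSnr addnAC; apply: PN.
Qed.

(** Shifting [m] by the period multiplies every term by
    [a ^ 4 * b ^ (4 m + 6)], thanks to [a ^ 2 = b ^ N]. *)
Lemma psi_mono_odd m :
  Wv m.*2.+3 = Wv m.+3 * Wv m.+1 ^+ 3 - Wv m * Wv m.+2 ^+ 3.
Proof.
move: m; apply: shift_ind => [m ltm|m IHm].
  apply: (odd_termsP FE); case/and4P: validD => _ _ _ /allP/(_ m).
  by rewrite mem_iota => /(_ ltm)/and3P[].
have -> : (m + N).*2.+3 = (m.*2.+3 + N + N)%N by lia.
rewrite -!addSn !psi_mono_shift IHm exprD -step_sqr -addnn !exprS exprD.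
by ring.
Qed.

Lemma psi_mono_even m : Wv m.*2.+4 * Wv 2 =
  Wv m.+1 ^+ 2 * Wv m.+2 * Wv m.+4 - Wv m * Wv m.+2 * Wv m.+3 ^+ 2.
Proof.
move: m; apply: shift_ind => [m ltm|m IHm].
  apply: (even_termsP FE); case/and4P: validD => _ _ _ /allP/(_ m).
  by rewrite mem_iota => /(_ ltm)/and3P[].
have -> : (m + N).*2.+4 = (m.*2.+4 + N + N)%N by lia.
rewrite -!addSn !psi_mono_shift.
transitivity (A * B ^+ (m.*2.+4 + N) * (A * B ^+ m.*2.+4) * (Wv m.*2.+4 * Wv 2)).
  by ring.
by rewrite IHm exprD -step_sqr -addnn !exprS exprD; ring.
Qed.

Lemma omega_mono_rec m : 2 * Wv 2 * Hv m.+2 =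
  Wv m.+1 ^+ 2 * Wv m.+4 - Wv m * Wv m.+3 ^+ 2
  + Wv 2 * Wv m.+2 *
    (peval x (curve_a1 D) * Wv m.+3 * Wv m.+1 - Wv 2 * Wv m.+2 ^+ 2).
Proof.
move: m; apply: shift_ind => [m ltm|m IHm].
  apply: (omega_termsP FE); case/and4P: validD => _ _ _ /allP/(_ m).
  by rewrite mem_iota => /(_ ltm)/and3P[].
rewrite -!addSn !psi_mono_shift omega_mono_shift.
transitivity (A ^+ 3 * B ^+ m.+2 ^+ 3 * (2 * Wv 2 * Hv m.+2)); first by ring.
by rewrite IHm !exprS; ring.
Qed.

Variable E : weierstrass.
Hypotheses (E1 : wa1 E = peval x (curve_a1 D)).
Hypotheses (E2 : wa2 E = mval fs F (curve_a2 D)).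
Hypotheses (E3 : wa3 E = mval fs F (W 2)).
Hypotheses (E4 : wa4 E = 0) (E6 : wa6 E = 0) (E3_neq0 : wa3 E != 0).

Theorem Hnum_mono n : Hnum E n = (mval fs F (H n))%:~R.
Proof.
case/and4P: validD => _ /and5P[_ /eqP w0 w1 h0 /eqP h1] /andP[w3 w4] _.
apply: (@Hnum_val E Wv Hv) => //.
- exact: mval0.
- exact: mval_one.
- by rewrite /Wv -E3.
- by rewrite E2; apply: (psi3_termsP FE).
- by rewrite E1 E2; apply: (psi4_termsP FE).
- exact: psi_mono_odd.
- exact: psi_mono_even.
- exact: mval_one.
- exact: mval0.
- by move=> m; rewrite E1; exact: omega_mono_rec.
Qed.

End QuasiPeriodic.

(** * Powers among the monomials *)

Section MonomialPowers.

Variables (fs : seq poly_list) (F : seq int).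
Hypothesis size_F : size F = size fs.
Hypothesis coprime_F : pairwise coprimez F.
Hypothesis F_neq0 : all (fun f => f != 0) F.

Lemma factor_neq0 i : (i < size fs)%N -> F`_i != 0.
Proof. by rewrite -size_F => lti; apply: (allP F_neq0); rewrite mem_nth. Qed.

Lemma mval_neq0 m : m.1 != 0 -> mval fs F m != 0.
Proof.
move=> m0; rewrite mulf_neq0 //; apply/prodf_neq0 => i _.
by rewrite expf_neq0 // factor_neq0.
Qed.

Lemma coprime_factors i j : (i < size fs)%N -> (j < size fs)%N -> i != j ->
  coprimez F`_i F`_j.
Proof.
rewrite -size_F => lti ltj; have /pairwiseP-/(_ 0) cop := coprime_F.
case: ltngtP => // lt_ij _; first exact: cop.
by rewrite coprimez_sym; apply: cop.
Qed.

(** The factors being pairwise coprime, each [F`_i ^ e_i] must be a [p]-th power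
    by itself. *)
Lemma mval_power p m : prime p -> `|m.1|%N = 1%N ->
  perfect_power p (mval fs F m) <->
  (forall i, (i < size fs)%N -> ~~ (p %| nth 0 m.2 i)%N -> perfect_power p F`_i).
Proof.
move=> pp m1; have p0 := prime_gt0 pp.
split=> [pow i lti not_p|pow].
  apply: (perfect_power_root pp not_p).
  move: pow; rewrite /mval (bigD1 (Ordinal lti)) //= mulrCA.
  apply: coprime_perfect_power => //; rewrite coprimezMr.
  apply/andP; split; first by rewrite coprimezE m1 coprimen1.
  apply: (big_ind (fun z => coprimez (F`_i ^+ nth 0%N m.2 i) z)).
  - by rewrite coprimezE coprimen1.
  - by move=> u v cu cv; rewrite coprimezMr cu.
  move=> j; rewrite -val_eqE eq_sym /= => neq_ij.
  by apply: coprimezXl; apply: coprimezXr; apply: coprime_factors.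
apply: perfect_powerM; first by exists 1%N; rewrite // exp1n.
apply: (big_ind (perfect_power p)) => [||i _].
- exact: perfect_power1.
- exact: perfect_powerM.
have [/dvdnP[d ->]|not_p] := boolP (p %| nth 0 m.2 i)%N.
  by rewrite exprM; apply/perfect_power_exp/expf_neq0/factor_neq0.
by apply/perfect_powerX/pow.
Qed.

End MonomialPowers.

Section Classification.

Variable (D : torsion_data).
Let N := torsion_order D.
Let k := size (factors D).

(** The indices of the factors of [omega_n(P)] that have to be [p]-th powers. *)
Definition non_multiples (p n : nat) : seq nat :=
  [seq i <- iota 0 k | ~~ (p %| nth 0 (omega_mono D n).2 i)]%N.

Definition unit_signs : bool :=
  [&& `|(step_a D).1|%N == 1%N, `|(step_b D).1|%N == 1%N
    & all (fun m => (`|m.1| <= 1)%N) (omega_tab D)].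

(** When the residue of an index modulo [M] satisfies [P], the set of factors at
    this index satisfies [T] or the value vanishes.  Checking [p * N] indices
    suffices, by [non_multiples_mod]. *)
Definition class_check (p M : nat) (P : pred nat) (T : pred (seq nat)) : bool :=
  (M %| p * N)%N &&
  all (fun m => P (m %% M)%N ==>
         ((omega_mono D m).1 == 0) || T (non_multiples p m)) (iota 0 (p * N)).

Lemma omega_sign n : unit_signs ->
  `|(omega_mono D n).1|%N = `|(nth (0%R, [::]) (omega_tab D) (n %% N)%N).1|%N.
Proof.
case/and3P=> /eqP a1 /eqP b1 _.
by rewrite /= !abszM !abszX a1 b1 !exp1n !mul1n.
Qed.

(** Modulo [p], the exponents [3 q ^ 2 A + 3 q r B + h] depend on [r] and on [q]
    modulo [p] only. *)
Lemma non_multiples_mod p n : (0 < N)%N ->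
  non_multiples p n = non_multiples p (n %% (p * N)).
Proof.
move=> N0; apply: eq_in_filter => i; rewrite mem_iota /= => lti.
rewrite /omega_mono -modn_divl modn_dvdm ?dvdn_mull //.
set q := (n %/ torsion_order D)%N; set r := (n %% torsion_order D)%N.
rewrite /mmul /eadd /= !nth_mkseq // !nth_scale.
move: (nth 0%N _ i) (nth 0%N _ i) (nth 0%N _ i) => h B A.
rewrite {1 2 3}(divn_eq q p); move: (q %/ p)%N (q %% p)%N => u v.
congr (~~ _).
rewrite (_ : (3 * _ * A + _)%N = ((3 * u * u * p + 6 * u * v) * A + 3 * u * r * B) * p
   + (3 * (v * v) * A + (3 * (v * r) * B + h)))%N; last by lia.
by rewrite dvdn_addr // dvdn_mull.
Qed.

Variables (x : int) (F : seq int) (E : weierstrass).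

(** The curve [E] is the member with parameter [x] of the family described by
    [D], and [F] lists the values of the factors at [x]. *)
Record torsion_model : Prop := TorsionModel {
  model_F : F = [seq peval x f | f <- factors D];
  model_valid : valid D && unit_signs && ((psi_mono D 2).1 != 0);
  model_neq0 : all (fun f => f != 0) F;
  model_coprime : pairwise coprimez F;
  model_a1 : wa1 E = peval x (curve_a1 D);
  model_a2 : wa2 E = mval (factors D) F (curve_a2 D);
  model_a3 : wa3 E = mval (factors D) F (psi_mono D 2);
  model_a4 : wa4 E = 0;
  model_a6 : wa6 E = 0 }.

Hypothesis model : torsion_model.

Lemma Hnum_modelE n : Hnum E n = (mval (factors D) F (omega_mono D n))%:~R.
Proof.
case: model => FE /andP[/andP[validD _] W2] nz cop e1 e2 e3 e4 e6.
apply: (Hnum_mono FE) => //; rewrite e3; apply: mval_neq0 => //.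
by rewrite FE size_map.
Qed.

Variables (p : nat) (Q : rat -> Prop).
Hypothesis QE : forall z : int, Q z%:~R <-> perfect_power p z.
Hypothesis p_prime : prime p.

Lemma Hnum_power n : Hnum E n != 0 ->
  Q (Hnum E n) <-> (forall i, i \in non_multiples p n -> Q (F`_i)%:~R).
Proof.
rewrite Hnum_modelE intr_eq0 QE => H0.
case: model => FE /andP[/andP[_ signs] _] nz cop _ _ _ _ _.
have c1 : `|(omega_mono D n).1|%N = 1%N.
  have : (omega_mono D n).1 != 0.
    by apply: contraNneq H0 => c0; apply/eqP/mval0.
  rewrite -absz_gt0 omega_sign //; case/and3P: signs => _ _ /allP le1.
  have [ltr|ler] := ltnP (n %% N)%N (size (omega_tab D)).
    by have := le1 _ (mem_nth (0, [::]) ltr); case: `|_|%N => [|[]].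
  by rewrite nth_default.
have sF : size F = size (factors D) by rewrite FE size_map.
rewrite (mval_power sF cop nz p_prime c1); split=> pow i.
  by rewrite mem_filter mem_iota QE => /andP[ni lti]; apply: pow.
by move=> lti ni; apply/QE/pow; rewrite mem_filter ni mem_iota.
Qed.

Lemma class_checkP M (P : pred nat) (T : pred (seq nat)) n :
  class_check p M P T -> P (n %% M)%N -> Hnum E n != 0 -> T (non_multiples p n).
Proof.
case/andP=> dvdM /allP check Pn; rewrite Hnum_modelE intr_eq0 => H0.
case: model => FE /andP[/andP[validD signs] _] nz cop _ _ _ _ _.
have N0 : (0 < N)%N by exact: torsion_gt0 validD.
have pN0 : (0 < p * N)%N by rewrite muln_gt0 prime_gt0.
have := check (n %% (p * N))%N; rewrite mem_iota ltn_mod pN0 modn_dvdm // Pn.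
rewrite -non_multiples_mod // => /(_ isT)/orP[|//].
rewrite -absz_eq0 omega_sign // modn_dvdm ?dvdn_mull // -omega_sign // absz_eq0.
by move=> /eqP c0; rewrite mval0 // eqxx in H0.
Qed.

Section Class.

Variables (M : nat) (P : pred nat) (n : nat).

Lemma class_always : class_check p M P (@nilp nat) -> Hnum E n != 0 ->
  P (n %% M)%N -> Q (Hnum E n).
Proof.
move=> check H0 Pn; apply/Hnum_power => // i.
by rewrite (nilP (class_checkP check Pn H0)).
Qed.

Lemma class_iff t : class_check p M P (eq_op^~ t) -> Hnum E n != 0 ->
  P (n %% M)%N -> Q (Hnum E n) <-> (forall i, i \in t -> Q (F`_i)%:~R).
Proof.
move=> check H0 Pn; have := Hnum_power H0.
by rewrite (eqP (class_checkP check Pn H0)).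
Qed.

Lemma class_iff1 j : class_check p M P (eq_op^~ [:: j]) -> Hnum E n != 0 ->
  P (n %% M)%N -> Q (Hnum E n) <-> Q (F`_j)%:~R.
Proof.
move=> check H0 Pn; rewrite (class_iff check H0 Pn).
by split=> [|Qj i]; [apply; rewrite inE | rewrite inE => /eqP ->].
Qed.

Lemma class_iff2 j l : (j < l < k)%N -> class_check p M P (eq_op^~ [:: j; l]) ->
  Hnum E n != 0 -> P (n %% M)%N -> Q (Hnum E n) <-> Q (F`_j * F`_l)%:~R.
Proof.
case/andP=> lt_jl ltl check H0 Pn; rewrite (class_iff check H0 Pn) QE.
case: model => FE _ nz cop _ _ _ _ _.
have sF : size F = size (factors D) by rewrite FE size_map.
have cop_jl : coprimez F`_j F`_l.
  apply: (coprime_factors sF cop) => //; first exact: ltn_trans lt_jl ltl.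
  by rewrite ltn_eqF.
have p0 := prime_gt0 p_prime.
split=> [pow|pow i].
  by apply: perfect_powerM; apply/QE/pow; rewrite !inE eqxx ?orbT.
rewrite !inE QE => /orP[] /eqP ->; first exact: coprime_perfect_power pow.
by move: pow; rewrite mulrC; apply: coprime_perfect_power; rewrite // coprimez_sym.
Qed.

(** The list [bad] collects sets of factors that cannot all be [p]-th powers. *)
Lemma class_never (bad : seq (seq nat)) :
  (forall t, t \in bad -> (forall i, i \in t -> perfect_power p F`_i) -> False) ->
  class_check p M P (fun s => has (all (mem s)) bad) -> Hnum E n != 0 ->
  P (n %% M)%N -> ~ Q (Hnum E n).
Proof.
move=> badP check H0 Pn /(Hnum_power H0) pow.
have /hasP[t tbad /allP sub_t] := class_checkP check Pn H0.
by apply: (badP t tbad) => i /sub_t /pow /QE.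
Qed.

End Class.

End Classification.

(** * The seven families *)

Section Tables.
Local Open Scope nat_scope.

Definition pos (e : seq nat) : mono := (1%R, e).
Definition neg (e : seq nat) : mono := ((-1)%R, e).
Definition zero : mono := (0%R, [::]).

(** In the tables below the factors are, in this order: [x] for the orders 4 and
    5; [x], [x + 1] for 6; [x], [x - 1] for 7; [x], [x - 1], [x ^ 2 - x + 1] for
    9; [x], [x - 1], [2 x - 1], [- x ^ 2 + 3 x - 1] for 10; and [x], [x - 1],
    [2 x - 1], [3 x ^ 2 - 3 x + 1], [2 x - 2 x ^ 2 - 1] for 12. *)
Definition data4 : torsion_data := {|
  torsion_order := 4;
  factors := [:: [:: 0; 1]%Z];
  curve_a1 := [:: 1]%Z;
  curve_a2 := neg [:: 1];
  step_a := neg [:: 6];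
  step_b := neg [:: 3];
  psi_tab := [::
    zero;
    pos [:: 0];
    neg [:: 1];
    neg [:: 3]];
  omega_tab := [::
    pos [:: 0];
    zero;
    zero;
    neg [:: 10]] |}.

Definition data5 : torsion_data := {|
  torsion_order := 5;
  factors := [:: [:: 0; 1]%Z];
  curve_a1 := [:: 1; -1]%Z;
  curve_a2 := neg [:: 1];
  step_a := neg [:: 10];
  step_b := pos [:: 4];
  psi_tab := [::
    zero;
    pos [:: 0];
    neg [:: 1];
    neg [:: 3];
    pos [:: 6]];
  omega_tab := [::
    pos [:: 0];
    zero;
    neg [:: 5];
    zero;
    pos [:: 19]] |}.

Definition data6 : torsion_data := {|
  torsion_order := 6;
  factors := [:: [:: 0; 1]%Z; [:: 1; 1]%Z];
  curve_a1 := [:: 1; -1]%Z;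
  curve_a2 := neg [:: 1; 1];
  step_a := pos [:: 15; 12];
  step_b := neg [:: 5; 4];
  psi_tab := [::
    zero;
    pos [:: 0; 0];
    neg [:: 1; 1];
    neg [:: 3; 3];
    pos [:: 6; 5];
    pos [:: 10; 8]];
  omega_tab := [::
    pos [:: 0; 0];
    zero;
    neg [:: 5; 4];
    neg [:: 11; 9];
    zero;
    pos [:: 31; 25]] |}.

Definition data7 : torsion_data := {|
  torsion_order := 7;
  factors := [:: [:: 0; 1]%Z; [:: -1; 1]%Z];
  curve_a1 := [:: 1; 1; -1]%Z;
  curve_a2 := neg [:: 2; 1];
  step_a := pos [:: 35; 21];
  step_b := pos [:: 10; 6];
  psi_tab := [::
    zero;
    pos [:: 0; 0];
    neg [:: 2; 1];
    neg [:: 6; 3];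
    pos [:: 11; 6];
    pos [:: 17; 10];
    neg [:: 25; 15]];
  omega_tab := [::
    pos [:: 0; 0];
    zero;
    neg [:: 9; 5];
    neg [:: 19; 11];
    pos [:: 35; 20];
    zero;
    neg [:: 77; 46]] |}.

Definition data9 : torsion_data := {|
  torsion_order := 9;
  factors := [:: [:: 0; 1]%Z; [:: -1; 1]%Z; [:: 1; -1; 1]%Z];
  curve_a1 := [:: 1; 0; 1; -1]%Z;
  curve_a2 := neg [:: 2; 1; 1];
  step_a := neg [:: 63; 36; 27];
  step_b := pos [:: 14; 8; 6];
  psi_tab := [::
    zero;
    pos [:: 0; 0; 0];
    neg [:: 2; 1; 1];
    neg [:: 6; 3; 3];
    pos [:: 12; 6; 5];
    pos [:: 19; 10; 8];
    neg [:: 27; 15; 12];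
    neg [:: 37; 21; 16];
    pos [:: 49; 28; 21]];
  omega_tab := [::
    pos [:: 0; 0; 0];
    zero;
    neg [:: 10; 5; 4];
    neg [:: 21; 11; 9];
    pos [:: 37; 20; 17];
    pos [:: 59; 32; 25];
    neg [:: 85; 47; 36];
    zero;
    pos [:: 149; 85; 64]] |}.

Definition data10 : torsion_data := {|
  torsion_order := 10;
  factors := [:: [:: 0; 1]%Z; [:: -1; 1]%Z; [:: -1; 2]%Z; [:: -1; 3; -1]%Z];
  curve_a1 := [:: 1; -5; 5; 6; -8; 2]%Z;
  curve_a2 := neg [:: 3; 1; 1; 2];
  step_a := pos [:: 105; 45; 40; 125];
  step_b := neg [:: 21; 9; 8; 25];
  psi_tab := [::
    zero;
    pos [:: 0; 0; 0; 0];
    neg [:: 3; 1; 1; 4];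
    neg [:: 9; 3; 3; 10];
    pos [:: 16; 6; 6; 19];
    pos [:: 25; 10; 10; 30];
    neg [:: 37; 15; 14; 44];
    neg [:: 51; 21; 19; 60];
    pos [:: 66; 28; 25; 79];
    pos [:: 84; 36; 32; 100]];
  omega_tab := [::
    pos [:: 0; 0; 0; 0];
    zero;
    neg [:: 13; 5; 5; 15];
    neg [:: 28; 11; 11; 34];
    pos [:: 52; 20; 19; 60];
    pos [:: 80; 32; 30; 94];
    neg [:: 113; 47; 44; 135];
    neg [:: 155; 65; 59; 184];
    zero;
    pos [:: 255; 109; 97; 304]] |}.

Definition data12 : torsion_data := {|
  torsion_order := 12;
  factors := [:: [:: 0; 1]%Z; [:: -1; 1]%Z; [:: -1; 2]%Z; [:: 1; -3; 3]%Z; [:: -1; 2; -2]%Z];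
  curve_a1 := [:: 1; -3; 0; 10; -14; 6]%Z;
  curve_a2 := pos [:: 1; 4; 1; 1; 1];
  step_a := neg [:: 66; 354; 60; 54; 48];
  step_b := neg [:: 11; 59; 10; 9; 8];
  psi_tab := [::
    zero;
    pos [:: 0; 0; 0; 0; 0];
    pos [:: 1; 8; 1; 1; 1];
    pos [:: 3; 20; 3; 3; 3];
    pos [:: 6; 37; 6; 6; 5];
    pos [:: 10; 60; 10; 9; 8];
    neg [:: 15; 86; 15; 13; 12];
    neg [:: 21; 119; 20; 18; 16];
    pos [:: 28; 155; 26; 24; 21];
    neg [:: 36; 197; 33; 30; 27];
    pos [:: 45; 244; 41; 37; 33];
    neg [:: 55; 295; 50; 45; 40]];
  omega_tab := [::
    pos [:: 0; 0; 0; 0; 0];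
    zero;
    pos [:: 5; 29; 5; 5; 4];
    pos [:: 11; 68; 11; 10; 9];
    neg [:: 20; 118; 20; 18; 17];
    neg [:: 32; 185; 31; 29; 25];
    pos [:: 47; 267; 45; 41; 36];
    neg [:: 65; 361; 62; 55; 50];
    pos [:: 86; 474; 80; 72; 64];
    neg [:: 110; 597; 101; 92; 81];
    zero;
    pos [:: 166; 893; 151; 136; 121]] |}.

End Tables.

Lemma consecutive_ge0 (x : int) : 0 <= x * (x - 1).
Proof. by nia. Qed.

Lemma model4 (alpha : int) : alpha != 0 ->
  torsion_model data4 alpha [:: alpha] (E4 alpha).
Proof.
move=> a0; split; [| by vm_compute | | | | | | by [] | by []].
- by congr [:: _]; rewrite /=; ring.
- by rewrite /= a0.
- by [].
- by rewrite /=; ring.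
- by rewrite mvalE /=; ring.
- by rewrite (_ : psi_mono data4 2 = neg [:: 1%N]) // mvalE /=; ring.
Qed.

Lemma model5 (alpha : int) : alpha != 0 ->
  torsion_model data5 alpha [:: alpha] (E5 alpha).
Proof.
move=> a0; split; [| by vm_compute | | | | | | by [] | by []].
- by congr [:: _]; rewrite /=; ring.
- by rewrite /= a0.
- by [].
- by rewrite /=; ring.
- by rewrite mvalE /=; ring.
- by rewrite (_ : psi_mono data5 2 = neg [:: 1%N]) // mvalE /=; ring.
Qed.

Lemma model6 (alpha : int) : alpha != -1 -> alpha != 0 ->
  torsion_model data6 alpha [:: alpha; alpha + 1] (E6 alpha).
Proof.
move=> aN1 a0; split; [| by vm_compute | | | | | | by [] | by []].
- by congr [:: _; _]; rewrite /=; ring.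
- by rewrite /= a0 addr_eq0 aN1.
- by rewrite /= !andbT; apply: (@bezout_coprimez (- 1) 1); ring.
- by rewrite /=; ring.
- by rewrite mvalE /=; ring.
- by rewrite (_ : psi_mono data6 2 = neg [:: 1; 1]%N) // mvalE /=; ring.
Qed.

Lemma model7 (alpha : int) : alpha != 0 -> alpha != 1 ->
  torsion_model data7 alpha [:: alpha; alpha - 1] (E7 alpha).
Proof.
move=> a0 a1; split; [| by vm_compute | | | | | | by [] | by []].
- by congr [:: _; _]; rewrite /=; ring.
- by rewrite /= a0 subr_eq0 a1.
- by rewrite /= !andbT; apply: (@bezout_coprimez 1 (- 1)); ring.
- by rewrite /=; ring.
- by rewrite mvalE /=; ring.
- by rewrite (_ : psi_mono data7 2 = neg [:: 2; 1]%N) // mvalE /=; ring.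
Qed.

Lemma model9 (alpha : int) : alpha != 0 -> alpha != 1 ->
  torsion_model data9 alpha
    [:: alpha; alpha - 1; alpha ^+ 2 - alpha + 1] (E9 alpha).
Proof.
move=> a0 a1; split; [| by vm_compute | | | | | | by [] | by []].
- by congr [:: _; _; _]; rewrite /=; ring.
- by have := consecutive_ge0 alpha; rewrite /= a0 subr_eq0 a1; lia.
- rewrite /= !andbT -!andbA; apply/and3P; split.
  + by apply: (@bezout_coprimez 1 (- 1)); ring.
  + by apply: (@bezout_coprimez (1 - alpha) 1); ring.
  + by apply: (@bezout_coprimez (- alpha) 1); ring.
- by rewrite /=; ring.
- by rewrite mvalE /=; ring.
- by rewrite (_ : psi_mono data9 2 = neg [:: 2; 1; 1]%N) // mvalE /=; ring.
Qed.

Lemma model10 (alpha : int) : alpha != 0 -> alpha != 1 ->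
  torsion_model data10 alpha
    [:: alpha; alpha - 1; 2 * alpha - 1; - alpha ^+ 2 + 3 * alpha - 1]
    (E10 alpha).
Proof.
move=> a0 a1; split; [| by vm_compute | | | | | | by [] | by []].
- by congr [:: _; _; _; _]; rewrite /=; ring.
- rewrite /= a0 subr_eq0 a1 !andbT; apply/andP; split; first by lia.
  have [le0|[->|[->|ge3]]] :
    alpha <= 0 \/ (alpha = 1 \/ (alpha = 2 \/ 3 <= alpha)) by lia.
  + by have : 0 <= alpha ^+ 2 by [rewrite sqr_ge0]; lia.
  + by [].
  + by [].
  + by have : 0 <= alpha * (alpha - 3) by [apply: mulr_ge0; lia]; lia.
- rewrite /= !andbT -!andbA; apply/and5P; split.
  + by apply: (@bezout_coprimez 1 (- 1)); ring.
  + by apply: (@bezout_coprimez 2 (- 1)); ring.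
  + by apply: (@bezout_coprimez (3 - alpha) (- 1)); ring.
  + by apply: (@bezout_coprimez (- 2) 1); ring.
  + apply/andP; split.
      by apply: (@bezout_coprimez (alpha - 2) 1); ring.
    by apply: (@bezout_coprimez (2 * alpha - 5) 4); ring.
- by rewrite /=; ring.
- by rewrite mvalE /=; ring.
- by rewrite (_ : psi_mono data10 2 = neg [:: 3; 1; 1; 4]%N) // mvalE /=; ring.
Qed.

Lemma model12 (alpha : int) : alpha != 0 -> alpha != 1 ->
  torsion_model data12 alpha
    [:: alpha; alpha - 1; 2 * alpha - 1; 3 * alpha ^+ 2 - 3 * alpha + 1;
        2 * alpha - 2 * alpha ^+ 2 - 1] (E12 alpha).
Proof.
move=> a0 a1; split; [| by vm_compute | | | | | | by [] | by []].
- by congr [:: _; _; _; _; _]; rewrite /=; ring.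
- by have := consecutive_ge0 alpha; rewrite /= a0 subr_eq0 a1; lia.
- rewrite /= !andbT -!andbA; repeat (apply/andP; split).
  + by apply: (@bezout_coprimez 1 (- 1)); ring.
  + by apply: (@bezout_coprimez 2 (- 1)); ring.
  + by apply: (@bezout_coprimez (3 - 3 * alpha) 1); ring.
  + by apply: (@bezout_coprimez (2 - 2 * alpha) (- 1)); ring.
  + by apply: (@bezout_coprimez (- 2) 1); ring.
  + by apply: (@bezout_coprimez (- 3 * alpha) 1); ring.
  + by apply: (@bezout_coprimez (- 2 * alpha) (- 1)); ring.
  + by apply: (@bezout_coprimez (3 - 6 * alpha) 4); ring.
  + by apply: (@bezout_coprimez (1 - 2 * alpha) (- 2)); ring.
  + by apply: (@bezout_coprimez (- 2) (- 3)); ring.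
- by rewrite /=; ring.
- by rewrite mvalE /=; ring.
- by rewrite (_ : psi_mono data12 2 = pos [:: 1; 8; 1; 1; 1]%N) // mvalE /=; ring.
Qed.

(** * Sets of factors that are not all powers *)

Lemma pred_perfect_powers p x : (1 < p)%N ->
  perfect_power p x -> perfect_power p (x - 1) -> False.
Proof.
move=> p1 px px1; apply: (consecutive_perfect_powers p1 px1).
by rewrite subrK.
Qed.

Section Incompatible.

Variables (p : nat) (alpha : int).
Hypothesis p1 : (1 < p)%N.
Local Notation powers F t := (forall i, i \in t -> perfect_power p F`_i).

Lemma incompatible6 t : t \in [:: [:: 0; 1]]%N ->
  powers [:: alpha; alpha + 1] t -> False.
Proof.
rewrite inE => /eqP -> pow.
exact: (consecutive_perfect_powers p1 (pow 0%N isT) (pow 1%N isT)).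
Qed.

Lemma incompatible_pred s t : t \in [:: [:: 0; 1]]%N ->
  powers [:: alpha, alpha - 1 & s] t -> False.
Proof.
rewrite inE => /eqP -> pow.
exact: (pred_perfect_powers p1 (pow 0%N isT) (pow 1%N isT)).
Qed.

End Incompatible.

Section IncompatibleFactors.

Variable alpha : int.
Hypotheses (a0 : alpha != 0) (a1 : alpha != 1).
Local Notation powers p F t := (forall i, i \in t -> perfect_power p F`_i).

Lemma incompatible9 t : t \in [:: [:: 0; 1]; [:: 2]]%N ->
  powers 2 [:: alpha; alpha - 1; alpha ^+ 2 - alpha + 1] t -> False.
Proof.
rewrite !inE => /orP[t01|/eqP ->]; first by apply: incompatible_pred; rewrite ?inE.
move=> /(_ 2%N isT)/square_conic[] /eqP alphaE; first by move: a0; rewrite alphaE.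
by move: a1; rewrite alphaE.
Qed.

Lemma incompatible10 t : t \in [:: [:: 0; 1]; [:: 1; 2; 3]]%N ->
  powers 3 [:: alpha; alpha - 1; 2 * alpha - 1; - alpha ^+ 2 + 3 * alpha - 1] t ->
  False.
Proof.
rewrite !inE => /orP[t01|/eqP ->]; first by apply: incompatible_pred; rewrite ?inE.
by move=> pow; apply: (no_cubes_zeta a0 a1 (pow 1%N isT) (pow 2%N isT) (pow 3%N isT)).
Qed.

Local Notation F12 :=
  [:: alpha; alpha - 1; 2 * alpha - 1; 3 * alpha ^+ 2 - 3 * alpha + 1;
      2 * alpha - 2 * alpha ^+ 2 - 1].

Lemma incompatible12_squares t : t \in [:: [:: 0; 1]; [:: 2; 4]]%N ->
  powers 2 F12 t -> False.
Proof.
rewrite !inE => /orP[t01|/eqP ->]; first by apply: incompatible_pred; rewrite ?inE.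
by move=> pow; apply: (no_squares_theta a0 a1 (pow 2%N isT) (pow 4%N isT)).
Qed.

Lemma incompatible12_cubes t : t \in [:: [:: 0; 1]; [:: 0; 3]; [:: 0; 2; 4]]%N ->
  powers 3 F12 t -> False.
Proof.
rewrite !inE => /or3P[t01|/eqP ->|/eqP ->] pow.
- by apply: incompatible_pred pow; rewrite ?inE.
- exact: (no_cubes_difference a0 a1 (pow 0%N isT) (pow 3%N isT)).
- exact: (no_cubes_theta a0 a1 (pow 0%N isT) (pow 2%N isT) (pow 4%N isT)).
Qed.

End IncompatibleFactors.

(** * Squares and cubes among the numerators *)

(** The argument left open is the [class_check], decided by computation.  In
    [class_iff1] and [class_iff2] the numbers after the class are positions in
    the list of factors. *)
Tactic Notation "by_class" uconstr(t) := refine t; vm_compute; reflexivity.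
Arguments class_always {D x F E} model {p Q} QE p_prime M P {n}.
Arguments class_iff1 {D x F E} model {p Q} QE p_prime M P {n}.
Arguments class_iff2 {D x F E} model {p Q} QE p_prime M P {n}.
Arguments class_never {D x F E} model {p Q} QE p_prime M P {n bad}.
Notation among l := (mem l%N).
Notation outside l := (predC (mem l%N)).

Theorem theoremB2 (alpha : int) (n : nat) :
  (alpha != 0 -> Hnum (E4 alpha) n != 0 ->
    (((n %% 8 \in [:: 0; 3; 4])%N -> is_square (Hnum (E4 alpha) n)) /\
     ((n %% 8 \notin [:: 0; 3; 4])%N -> (is_square (Hnum (E4 alpha) n) <-> is_square alpha%:~R))) /\
    (((n %% 4 \in [:: 0])%N -> is_cube (Hnum (E4 alpha) n)) /\
     ((n %% 4 \notin [:: 0])%N -> (is_cube (Hnum (E4 alpha) n) <-> is_cube alpha%:~R)))) /\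
  (alpha != 0 -> Hnum (E5 alpha) n != 0 ->
    (((n %% 5 \in [:: 0])%N -> is_square (Hnum (E5 alpha) n)) /\
     ((n %% 5 \notin [:: 0])%N -> (is_square (Hnum (E5 alpha) n) <-> is_square alpha%:~R))) /\
    (((n %% 5 \in [:: 0])%N -> is_cube (Hnum (E5 alpha) n)) /\
     ((n %% 5 \notin [:: 0])%N -> (is_cube (Hnum (E5 alpha) n) <-> is_cube alpha%:~R)))) /\
  (alpha != -1 -> alpha != 0 -> Hnum (E6 alpha) n != 0 ->
    (((n %% 12 \in [:: 0; 8])%N -> is_square (Hnum (E6 alpha) n)) /\
     ((n %% 12 \in [:: 2; 6])%N -> (is_square (Hnum (E6 alpha) n) <-> is_square alpha%:~R)) /\
     ((n %% 12 \notin [:: 0; 8; 2; 6])%N -> ~ is_square (Hnum (E6 alpha) n))) /\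
    (((n %% 6 \in [:: 0])%N -> is_cube (Hnum (E6 alpha) n)) /\
     ((n %% 6 \in [:: 3])%N -> (is_cube (Hnum (E6 alpha) n) <-> is_cube alpha%:~R)) /\
     ((n %% 6 \notin [:: 0; 3])%N -> ~ is_cube (Hnum (E6 alpha) n)))) /\
  (alpha != 0 -> alpha != 1 -> Hnum (E7 alpha) n != 0 ->
    (((n %% 14 \in [:: 0; 9; 10])%N -> is_square (Hnum (E7 alpha) n)) /\
     ((n %% 14 \in [:: 4; 6])%N -> (is_square (Hnum (E7 alpha) n) <-> is_square alpha%:~R)) /\
     ((n %% 14 \in [:: 11; 13])%N -> (is_square (Hnum (E7 alpha) n) <-> is_square (alpha - 1)%:~R)) /\
     ((n %% 14 \notin [:: 0; 9; 10; 4; 6; 11; 13])%N -> ~ is_square (Hnum (E7 alpha) n))) /\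
    (((n %% 7 \in [:: 0])%N -> is_cube (Hnum (E7 alpha) n)) /\
     ((n %% 7 \in [:: 2])%N -> (is_cube (Hnum (E7 alpha) n) <-> is_cube (alpha - 1)%:~R)) /\
     ((n %% 7 \notin [:: 0; 2])%N -> ~ is_cube (Hnum (E7 alpha) n)))) /\
  (alpha != 0 -> alpha != 1 -> Hnum (E9 alpha) n != 0 ->
    (((n %% 18 \in [:: 0; 13; 14])%N -> is_square (Hnum (E9 alpha) n)) /\
     ((n %% 18 \in [:: 2; 12])%N -> (is_square (Hnum (E9 alpha) n) <-> is_square (alpha - 1)%:~R)) /\
     ((n %% 18 \notin [:: 0; 13; 14; 2; 12])%N -> ~ is_square (Hnum (E9 alpha) n))) /\
    (((n %% 9 \in [:: 0])%N -> is_cube (Hnum (E9 alpha) n)) /\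
     ((n %% 9 \in [:: 3])%N -> (is_cube (Hnum (E9 alpha) n) <-> is_cube (alpha - 1)%:~R)) /\
     ((n %% 9 \notin [:: 0; 3])%N -> ~ is_cube (Hnum (E9 alpha) n)))) /\
  (alpha != 0 -> alpha != 1 -> Hnum (E10 alpha) n != 0 ->
    (((n %% 20 \in [:: 0; 5; 15; 16])%N -> is_square (Hnum (E10 alpha) n)) /\
     ((n %% 20 \in [:: 4; 12])%N -> (is_square (Hnum (E10 alpha) n) <-> is_square (2 * alpha - 1)%:~R)) /\
     ((n %% 20 \in [:: 3; 13])%N -> (is_square (Hnum (E10 alpha) n) <-> is_square ((alpha - 1) * (2 * alpha - 1))%:~R)) /\
     ((n %% 20 \notin [:: 0; 5; 15; 16; 4; 12; 3; 13])%N -> ~ is_square (Hnum (E10 alpha) n))) /\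
    (((n %% 10 \in [:: 0])%N -> is_cube (Hnum (E10 alpha) n)) /\
     ((n %% 10 \notin [:: 0])%N -> ~ is_cube (Hnum (E10 alpha) n)))) /\
  (alpha != 0 -> alpha != 1 -> Hnum (E12 alpha) n != 0 ->
    (((n %% 24 \in [:: 0; 8; 12; 19; 20])%N -> is_square (Hnum (E12 alpha) n)) /\
     ((n %% 24 \in [:: 4; 16])%N -> (is_square (Hnum (E12 alpha) n) <-> is_square (2 * alpha - 2 * alpha ^+ 2 - 1)%:~R)) /\
     ((n %% 24 \notin [:: 0; 8; 12; 19; 20; 4; 16])%N -> ~ is_square (Hnum (E12 alpha) n))) /\
    (((n %% 12 \in [:: 0])%N -> is_cube (Hnum (E12 alpha) n)) /\
     ((n %% 12 \notin [:: 0])%N -> ~ is_cube (Hnum (E12 alpha) n)))).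
Proof.
split; last split; last split; last split; last split; last split.
- move=> a0 H0; have M := model4 a0; split; split.
  + by_class (class_always M is_squareE isT 8 (among [:: 0; 3; 4]) _ H0).
  + by_class (class_iff1 M is_squareE isT 8 (outside [:: 0; 3; 4]) 0 _ H0).
  + by_class (class_always M is_cubeE isT 4 (among [:: 0]) _ H0).
  + by_class (class_iff1 M is_cubeE isT 4 (outside [:: 0]) 0 _ H0).
- move=> a0 H0; have M := model5 a0; split; split.
  + by_class (class_always M is_squareE isT 5 (among [:: 0]) _ H0).
  + by_class (class_iff1 M is_squareE isT 5 (outside [:: 0]) 0 _ H0).
  + by_class (class_always M is_cubeE isT 5 (among [:: 0]) _ H0).
  + by_class (class_iff1 M is_cubeE isT 5 (outside [:: 0]) 0 _ H0).
- move=> aN1 a0 H0; have M := model6 aN1 a0; split; (split; last split).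
  + by_class (class_always M is_squareE isT 12 (among [:: 0; 8]) _ H0).
  + by_class (class_iff1 M is_squareE isT 12 (among [:: 2; 6]) 0 _ H0).
  + by_class (class_never M is_squareE isT 12 (outside [:: 0; 8; 2; 6])
                (@incompatible6 2 alpha isT) _ H0).
  + by_class (class_always M is_cubeE isT 6 (among [:: 0]) _ H0).
  + by_class (class_iff1 M is_cubeE isT 6 (among [:: 3]) 0 _ H0).
  + by_class (class_never M is_cubeE isT 6 (outside [:: 0; 3])
                (@incompatible6 3 alpha isT) _ H0).
- move=> a0 a1 H0; have M := model7 a0 a1; split.
  + split; last split; last split.
    * by_class (class_always M is_squareE isT 14 (among [:: 0; 9; 10]) _ H0).
    * by_class (class_iff1 M is_squareE isT 14 (among [:: 4; 6]) 0 _ H0).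
    * by_class (class_iff1 M is_squareE isT 14 (among [:: 11; 13]) 1 _ H0).
    * by_class (class_never M is_squareE isT 14
                  (outside [:: 0; 9; 10; 4; 6; 11; 13])
                  (@incompatible_pred 2 alpha isT _) _ H0).
  + split; last split.
    * by_class (class_always M is_cubeE isT 7 (among [:: 0]) _ H0).
    * by_class (class_iff1 M is_cubeE isT 7 (among [:: 2]) 1 _ H0).
    * by_class (class_never M is_cubeE isT 7 (outside [:: 0; 2])
                  (@incompatible_pred 3 alpha isT _) _ H0).
- move=> a0 a1 H0; have M := model9 a0 a1; split; (split; last split).
  + by_class (class_always M is_squareE isT 18 (among [:: 0; 13; 14]) _ H0).
  + by_class (class_iff1 M is_squareE isT 18 (among [:: 2; 12]) 1 _ H0).
  + by_class (class_never M is_squareE isT 18 (outside [:: 0; 13; 14; 2; 12])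
                (incompatible9 a0 a1) _ H0).
  + by_class (class_always M is_cubeE isT 9 (among [:: 0]) _ H0).
  + by_class (class_iff1 M is_cubeE isT 9 (among [:: 3]) 1 _ H0).
  + by_class (class_never M is_cubeE isT 9 (outside [:: 0; 3])
                (@incompatible_pred 3 alpha isT _) _ H0).
- move=> a0 a1 H0; have M := model10 a0 a1; split.
  + split; last split; last split.
    * by_class (class_always M is_squareE isT 20 (among [:: 0; 5; 15; 16]) _ H0).
    * by_class (class_iff1 M is_squareE isT 20 (among [:: 4; 12]) 2 _ H0).
    * by_class (class_iff2 M is_squareE isT 20 (among [:: 3; 13]) 1 2 isT _ H0).
    * by_class (class_never M is_squareE isT 20
                  (outside [:: 0; 5; 15; 16; 4; 12; 3; 13])
                  (@incompatible_pred 2 alpha isT _) _ H0).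
  + split.
    * by_class (class_always M is_cubeE isT 10 (among [:: 0]) _ H0).
    * by_class (class_never M is_cubeE isT 10 (outside [:: 0])
                  (incompatible10 a0 a1) _ H0).
- move=> a0 a1 H0; have M := model12 a0 a1; split.
  + split; last split.
    * by_class (class_always M is_squareE isT 24 (among [:: 0; 8; 12; 19; 20]) _ H0).
    * by_class (class_iff1 M is_squareE isT 24 (among [:: 4; 16]) 4 _ H0).
    * by_class (class_never M is_squareE isT 24
                  (outside [:: 0; 8; 12; 19; 20; 4; 16])
                  (incompatible12_squares a0 a1) _ H0).
  + split.
    * by_class (class_always M is_cubeE isT 12 (among [:: 0]) _ H0).
    * by_class (class_never M is_cubeE isT 12 (outside [:: 0])
                  (incompatible12_cubes a0 a1) _ H0).
Qed.
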